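(* Let $\Omega\subset\mathbb{R}^n$ be a bounded $C^2$ domain, let $0\le f\in C^{\alpha}(\overline{\Omega})$ for some $0<\alpha<1$ with $f\not\equiv 0$, and let $0<g\in C^2((-\infty,1))$ satisfy $g'(s)\le 0$ for all $s<1$. Let $$\lambda>\lambda':=\mu_1\frac{\int_0^1g(s)\,ds}{\int_\Omega f\phi_1\,dx},$$ and let $u$ be a solution of (P) with initial value $u_0$ (where $u_0\in L^1(\Omega)$, $u_0\le a$ for some constant $a\in(0,1)$), continued to its maximal interval of existence. Then the touchdown time $T_\lambda$ of $u$ satisfies $$T_\lambda\le\frac{1}{\lambda-\lambda'}\cdot\frac{\int_\Omega H(u_0)\phi_1\,dx}{\int_\Omega f\phi_1\,dx},\qquad\text{where } H(v)=\int_v^1g(s)\,ds.$$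
   Context: (P) denotes the problem $u_t=\Delta u+\lambda f(x)/g(u)$ in $\Omega\times(0,T)$, $u=0$ on $\partial\Omega\times(0,T)$, $u(x,0)=u_0$ in $\Omega$. A solution of (P) in $\Omega\times(0,T)$ ($0<T\le\infty$) is a function $u\in C^{2,1}(\Omega\times(0,T))\cap C(\overline{\Omega}\times(0,T))$ satisfying the equation, $u=0$ on $\partial\Omega\times(0,T)$, $\sup_{\overline{\Omega}\times(0,T']}u<1$ for all $0<T'<T$, and $\|u(\cdot,t)-u_0\|_{L^1(\Omega)}\to 0$ as $t\to 0$. The touchdown time $T_\lambda\in(0,\infty]$ of $u$ is the time such that $\sup_\Omega u(\cdot,t)<1$ for all $0<t<T_\lambda$ and $\lim_{t\nearrow T_\lambda}\sup_\Omega u(\cdot,t)=1$. (The right-hand side of the bound may be $+\infty$, in which case the bound is vacuous.) $\mu_1>0$ is the first Dirichlet eigenvalue of $-\Delta$ in $\Omega$ and $\phi_1$ is the corresponding positive eigenfunction normalized by $\int_\Omega\phi_1\,dx=1$. *)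

(* Defs.v *)
From HB Require Import structures.
From mathcomp Require Import all_boot all_order all_algebra.
From mathcomp Require Import all_classical all_reals all_analysis.

Set Implicit Arguments.
Unset Strict Implicit.
Unset Printing Implicit Defensive.

Import Order.TTheory GRing.Theory Num.Theory.
Import numFieldNormedType.Exports.

Local Open Scope classical_set_scope.
Local Open Scope ring_scope.

(* 'rV[R]_n is given the sigma-algebra generated by the coordinates, which is
   the Borel sigma-algebra of R^n.  *)
Definition measure_rV_display : measure_display -> measure_display.
Proof. exact. Qed.

Section measurable_rV.
Context {d} {T : measurableType d}.
Variable n : nat.

Let coors : 'I_n -> 'rV[T]_n -> T := fun i x => x ord0 i.

Let rV_set0 : g_sigma_preimage coors set0.
Proof. exact: sigma_algebra0. Qed.

Let rV_setC A : g_sigma_preimage coors A -> g_sigma_preimage coors (~` A).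
Proof. exact: sigma_algebraC. Qed.

Let rV_bigcup (F : _^nat) : (forall i, g_sigma_preimage coors (F i)) ->
  g_sigma_preimage coors (\bigcup_i (F i)).
Proof. exact: sigma_algebra_bigcup. Qed.

HB.instance Definition _ := @isMeasurable.Build (measure_rV_display d)
  'rV[T]_n (g_sigma_preimage coors) rV_set0 rV_setC rV_bigcup.

Lemma measurable_coor (i : 'I_n) :
  measurable_fun [set: 'rV[T]_n] (fun x => x ord0 i).
Proof.
move=> _ Y mY; rewrite setTI; apply: sub_sigma_algebra => /=.
rewrite -bigcup_seq/=; exists i => /=; first by rewrite mem_index_enum.
by exists Y => //; rewrite setTI.
Qed.

Lemma measurable_fun_rV d1 (T1 : measurableType d1) (f : T1 -> 'rV[T]_n) :
  (forall i, measurable_fun [set: T1] (fun x => f x ord0 i)) ->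
  measurable_fun [set: T1] f.
Proof.
move=> mf.
have H : g_sigma_preimage coors `<=` [set A | measurable (f @^-1` A)].
  apply: smallest_sub.
    split => /=.
    - by rewrite preimage_set0; exact: measurable0.
    - by move=> A mA; rewrite setTD preimage_setC; exact: measurableC.
    - by move=> F mF; rewrite preimage_bigcup; exact: bigcupT_measurable.
  move=> A; rewrite -bigcup_seq => -[i _ [B mB <-]] /=.
  rewrite setTI -[X in measurable X]setTI.
  exact: (mf i).
by move=> _ A mA; rewrite setTI; exact: H.
Qed.

End measurable_rV.

Section lebesgue_rV.
Variable R : realType.

Definition rV_cons n (p : R * 'rV[R]_n) : 'rV[R]_n.+1 :=
  row_mx (const_mx p.1 : 'rV[R]_1) p.2.

Definition rV_uncons n (x : 'rV[R]_n.+1) : R * 'rV[R]_n :=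
  (x ord0 ord0, \row_i x ord0 (lift ord0 i)).

Lemma rV_consK n : cancel (@rV_cons n) (@rV_uncons n).
Proof.
case=> a v; rewrite /rV_uncons /rV_cons /=; congr pair.
  rewrite (_ : ord0 = lshift n (ord0 : 'I_1)); last exact/val_inj.
  by rewrite (row_mxEl (const_mx a : 'rV[R]_1)) mxE.
apply/rowP => i; rewrite mxE.
rewrite (_ : lift ord0 i = rshift 1 i); last exact/val_inj.
by rewrite (row_mxEr (const_mx a : 'rV[R]_1)).
Qed.

Lemma measurable_rV_cons n :
  measurable_fun [set: R * 'rV[R]_n]
    (@rV_cons n : _ -> 'rV[R]_n.+1).
Proof.
apply: measurable_fun_rV => i.
have [k ->|k ->] := fintype.split_ordP (i : 'I_(1 + n)).
  rewrite (_ : (fun _ => _) = fst); first exact: measurable_fst.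
  apply/funext => -[a v] /=.
  by rewrite /rV_cons (row_mxEl (const_mx a : 'rV[R]_1)) mxE.
rewrite (_ : (fun _ => _) = (fun v : 'rV_n => v ord0 k) \o snd).
  by apply: measurableT_comp; [exact: measurable_coor|exact: measurable_snd].
apply/funext => -[a v] /=.
by rewrite /rV_cons (row_mxEr (const_mx a : 'rV[R]_1)).
Qed.

Lemma measurable_rV_uncons n :
  measurable_fun [set: 'rV[R]_n.+1]
    (@rV_uncons n : _ -> R * 'rV[R]_n).
Proof.
apply/measurable_fun_pairP; split; first exact: measurable_coor.
apply: measurable_fun_rV => i; rewrite (_ : (fun _ => _) =
  (fun x : 'rV[R]_n.+1 => x ord0 (lift ord0 i))).
  exact: measurable_coor.
by apply/funext => x; rewrite /= mxE.
Qed.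

Section push_cons.
Variables (n : nat) (mu : {sigma_finite_measure set 'rV[R]_n -> \bar R}).

Definition lebesgue_rV_cons : set 'rV[R]_n.+1 -> \bar R :=
  pushforward (@lebesgue_measure R \x mu)%E (@rV_cons n).

Let push0 : lebesgue_rV_cons set0 = 0%E.
Proof. by rewrite /lebesgue_rV_cons /pushforward preimage_set0 measure0. Qed.

Let push_ge0 A : (0 <= lebesgue_rV_cons A)%E.
Proof.
exact: (measure_ge0 (@lebesgue_measure R \x mu)%E (@rV_cons n @^-1` A)).
Qed.

Let push_additive : semi_sigma_additive lebesgue_rV_cons.
Proof.
move=> F mF tF mUF; rewrite /lebesgue_rV_cons /pushforward preimage_bigcup.
have mcons := @measurable_rV_cons n.
apply: measure_semi_sigma_additive.
- by move=> k; rewrite -[X in measurable X]setTI; exact: mcons.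
- apply/trivIsetP => /= i j _ _ ij; rewrite -preimage_setI.
  by move/trivIsetP : tF => /(_ _ _ _ _ ij) ->//; rewrite preimage_set0.
- by rewrite -preimage_bigcup -[X in measurable X]setTI; exact: mcons.
Qed.

HB.instance Definition _ := isMeasure.Build _ _ _ lebesgue_rV_cons
  push0 push_ge0 push_additive.

Let prod_sigma_finite : sigma_finite setT (@lebesgue_measure R \x mu)%E.
Proof.
have /sigma_finiteP[F [TF ndF Foo]] := sigma_finiteT (@lebesgue_measure R).
have /sigma_finiteP[G [TG ndG Goo]] := sigma_finiteT mu.
exists (fun k => F k `*` G k).
  rewrite -setXTT TF TG predeqE => -[x y]; split.
    move=> [/= [k _ Fkx] [l _ Gly]]; exists (maxn k l) => //; split.
    - by move: x Fkx; exact/subsetPset/ndF/leq_maxl.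
    - by move: y Gly; exact/subsetPset/ndG/leq_maxr.
  by move=> [k _ []/= ? ?]; split; exists k.
move=> k; have [? ?] := Foo k; have [? ?] := Goo k.
split; first exact: measurableX.
by rewrite product_measure1E// lte_mul_pinfty// ge0_fin_numE.
Qed.

Let push_sigma_finite : sigma_finite setT lebesgue_rV_cons.
Proof.
have [F FT mF] := prod_sigma_finite.
exists (fun k => @rV_uncons n @^-1` F k).
  by rewrite -preimage_bigcup -FT preimage_setT.
move=> k; have [mFk Fk] := mF k; split.
  by rewrite -[X in measurable X]setTI; exact: measurable_rV_uncons.
rewrite /lebesgue_rV_cons /pushforward -comp_preimage.
rewrite (_ : _ \o _ = id) ?preimage_id//.
by apply/funext => x; exact: rV_consK.
Qed.

HB.instance Definition _ := Measure_isSigmaFinite.Build _ _ _ lebesgue_rV_cons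
  push_sigma_finite.

End push_cons.

(* n-dimensional Lebesgue measure, as the iterated product of n copies of the
   one-dimensional one, transported to row vectors by rV_cons. *)
Fixpoint lebesgue_rV n : {sigma_finite_measure set 'rV[R]_n -> \bar R} :=
  if n is m.+1 then lebesgue_rV_cons (lebesgue_rV m)
  else \d_(0 : 'rV[R]_0).

End lebesgue_rV.

Section calculus.
Variable R : realType.

(* The partial derivative d/dx_i is 'D_(base_rV i). *)
Definition base_rV n (i : 'I_n) : 'rV[R]_n := delta_mx ord0 i.

Definition laplacian n (v : 'rV[R]_n -> R) (x : 'rV[R]_n) : R :=
  \sum_(i < n) 'D_(base_rV i) ('D_(base_rV i) v) x.

(* Meant for open sets A, where {within A, continuous _} is plain continuity
   at the points of A. *)
Definition C2_on n (A : set 'rV[R]_n) (v : 'rV[R]_n -> R) : Prop :=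
  [/\ {within A, continuous v},
      forall i, (forall x, A x -> derivable v x (base_rV i)) /\
        {within A, continuous ('D_(base_rV i) v)} &
      forall i j, (forall x, A x -> derivable ('D_(base_rV i) v) x (base_rV j)) /\
        {within A, continuous ('D_(base_rV j) ('D_(base_rV i) v))}].

(* g is of class C^2 on ]-oo, 1[; values of g on [1, +oo[ are irrelevant *)
Definition C2_lt1 (g : R -> R) : Prop :=
  forall s, s < 1 ->
    [/\ derivable g s 1, derivable g^`()%classic s 1 & {for s, continuous g^`(2)%classic}].

Definition boundary n (A : set 'rV[R]_n) : set 'rV[R]_n :=
  closure A `\` interior A.

(* The boundary is locally the graph of a C^2 function over one of the
   coordinate hyperplanes, and A lies locally on one side of it; the boolean b
   chooses the side.  (Balls are those of the sup norm of 'rV[R]_n.) *)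
Definition C2_boundary n (A : set 'rV[R]_n) : Prop :=
  forall x0, boundary A x0 ->
  exists r : R, 0 < r /\
  exists (i : 'I_n) (b : bool) (gamma : 'rV[R]_n.-1 -> R),
    C2_on setT gamma /\
    forall x, ball x0 r x -> (A x <-> gamma (col' i x) < (-1) ^+ b * x ord0 i).

Definition bounded_C2_domain n (A : set 'rV[R]_n) : Prop :=
  [/\ A !=set0, open A, connected A, bounded_set A & C2_boundary A].

(* Hoelder continuity does not depend on the choice of a norm on R^n. *)
Definition hoelder_on n (alpha : R) (A : set 'rV[R]_n) (f : 'rV[R]_n -> R) :
    Prop :=
  exists C : R, forall x y, A x -> A y ->
    `|f x - f y| <= C * (`|x - y| `^ alpha).

Definition dirichlet_eigenfunction n (Omega : set 'rV[R]_n) (mu : R)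
    (phi : 'rV[R]_n -> R) : Prop :=
  [/\ C2_on Omega phi,
      {within closure Omega, continuous phi},
      forall x, Omega x -> - laplacian phi x = mu * phi x,
      forall x, boundary Omega x -> phi x = 0 &
      exists2 x, Omega x & phi x != 0].

Definition dirichlet_eigenvalue n (Omega : set 'rV[R]_n) (mu : R) : Prop :=
  exists phi, dirichlet_eigenfunction Omega mu phi.

Definition first_dirichlet_eigenvalue n (Omega : set 'rV[R]_n) (mu1 : R) :
    Prop :=
  dirichlet_eigenvalue Omega mu1 /\
  forall mu, dirichlet_eigenvalue Omega mu -> mu1 <= mu.

Definition normalized_eigenfunction n (Omega : set 'rV[R]_n) (mu1 : R)
    (phi1 : 'rV[R]_n -> R) : Prop :=
  [/\ dirichlet_eigenfunction Omega mu1 phi1,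
      forall x, Omega x -> 0 < phi1 x &
      (\int[lebesgue_rV R n]_(x in Omega) (phi1 x)%:E)%E = 1%:E].

(* the open interval ]0, T[ of R, for T possibly +oo *)
Definition times (T : \bar R) : set R := [set t | (0%:E < t%:E < T)%E].

(* u, u_t, u_{x_i}, u_{x_i x_j} exist and are continuous in (x, t) *)
Definition C21_on n (Omega : set 'rV[R]_n) (T : \bar R)
    (u : 'rV[R]_n -> R -> R) : Prop :=
  let Q := Omega `*` times T in
  [/\ {within Q, continuous (fun p => u p.1 p.2)},
      (forall x t, Q (x, t) -> derivable (u x) t 1) /\
        {within Q, continuous (fun p => (u p.1)^`()%classic p.2)},
      forall i, (forall x t, Q (x, t) -> derivable (u ^~ t) x (base_rV i)) /\
        {within Q, continuous (fun p => 'D_(base_rV i) (u ^~ p.2) p.1)} &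
      forall i j,
        (forall x t, Q (x, t) ->
          derivable ('D_(base_rV i) (u ^~ t)) x (base_rV j)) /\
        {within Q, continuous (fun p =>
          'D_(base_rV j) ('D_(base_rV i) (u ^~ p.2)) p.1)}].

(* ereal_sup is used so that the bound sup u < 1 also asserts that u is bounded
   above (real sup would be 0 on unbounded sets). *)
Definition solution n (Omega : set 'rV[R]_n) (f : 'rV[R]_n -> R) (g : R -> R)
    (lambda : R) (u0 : 'rV[R]_n -> R) (T : \bar R) (u : 'rV[R]_n -> R -> R) :
    Prop :=
  (0%:E < T)%E /\
  [/\ C21_on Omega T u,
      {within closure Omega `*` times T, continuous (fun p => u p.1 p.2)},
      forall x t, Omega x -> times T t ->
        (u x)^`()%classic t = laplacian (u ^~ t) x + lambda * f x / g (u x t),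
      forall x t, boundary Omega x -> times T t -> u x t = 0 &
      forall T' : R, times T T' ->
        (ereal_sup [set (u p.1 p.2)%:E |
          p in closure Omega `*` `]0%R, T']] < 1%:E)%E] /\
  (\int[lebesgue_rV R n]_(x in Omega) `|u x t - u0 x|%:E)%E
    @[t --> 0^'+] --> 0%:E.

Definition maximal_solution n (Omega : set 'rV[R]_n) (f : 'rV[R]_n -> R)
    (g : R -> R) (lambda : R) (u0 : 'rV[R]_n -> R) (T : \bar R)
    (u : 'rV[R]_n -> R -> R) : Prop :=
  solution Omega f g lambda u0 T u /\
  forall (T' : \bar R) (v : 'rV[R]_n -> R -> R),
    (T <= T')%E -> solution Omega f g lambda u0 T' v ->
    (forall x t, closure Omega x -> times T t -> v x t = u x t) ->
    T' = T.

(* Tl is the touchdown time of the solution u on Omega x ]0, T[.  By convention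
   Tl = +oo means that u does not touch down in finite time, whatever its
   behaviour as t tends to +oo. *)
Definition touchdown_time n (Omega : set 'rV[R]_n) (T : \bar R)
    (u : 'rV[R]_n -> R -> R) (Tl : \bar R) : Prop :=
  let M t := ereal_sup [set (u x t)%:E | x in Omega] in
  [/\ (0%:E < Tl <= T)%E,
      forall t, times Tl t -> (M t < 1%:E)%E &
      forall t1 : R, Tl = t1%:E -> M t @[t --> t1^'-] --> 1%:E].

(* For v >= 1 the domain is empty and the value is 0: junk, as g is only
   meaningful on ]-oo, 1[. *)
Definition H_of (g : R -> R) (v : R) : R :=
  \int[lebesgue_measure]_(s in `]v, 1[) g s.

Definition integral_f_phi n (Omega : set 'rV[R]_n)
    (f phi : 'rV[R]_n -> R) : R :=
  \int[lebesgue_rV R n]_(x in Omega) (f x * phi x).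

Definition lambda' n (Omega : set 'rV[R]_n) (f : 'rV[R]_n -> R) (g : R -> R)
    (mu1 : R) (phi1 : 'rV[R]_n -> R) : R :=
  mu1 * (\int[lebesgue_measure]_(s in `]0, 1[) g s) / integral_f_phi Omega f phi1.

End calculus.

(* Main.v *)
Require Import Defs.
From mathcomp Require Import all_boot all_order all_algebra.
From mathcomp Require Import all_classical all_reals all_analysis.
From mathcomp Require Import measurable_realfun.
From mathcomp Require Import ring lra.

Import Order.TTheory GRing.Theory Num.Theory.
Import numFieldNormedType.Exports.

Local Open Scope classical_set_scope.
Local Open Scope ring_scope.

(* Set H(v) = \int_v^1 g.  Formally E(t) = \int_Omega H(u) phi_1 satisfies
     E' <= - mu_1 E + mu_1 H(0) - lambda \int_Omega f phi_1
        <= - (lambda - lambda') \int_Omega f phi_1,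
   by Green's formula and g' <= 0, and E >= 0 then bounds the existence time.
   Two points need care.
   - Neither u nor phi_1 is assumed to be differentiable up to the boundary, so
     phi_1 is replaced by w = psi(phi_1), with psi convex, vanishing near 0 and
     of slope one away from 0.  As w has compact support, Green's formula is
     elementary.  The extra term (H(u) - H(0)) psi''(phi_1) |grad phi_1|^2 lives
     near the boundary, where H(u) - kappa <= 0 for any fixed kappa > H(0).
   - H need not be Lipschitz near -oo, so L^1 convergence of u(t) to u_0 does
     not give convergence of E.  One uses g o m in place of g, where m is a C^1
     nondecreasing function, bounded below, with m(s) >= s, and m(s) = s for
     s >= - M.  This only decreases the initial energy; if - M bounds u below on
     [t_1, t_2], the full decay rate is kept there, and on (0, t_1] dropping the
     source term costs at most mu_1 H(0) t_1, which vanishes as t_1 -> 0. *)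

Set Implicit Arguments.
Unset Strict Implicit.
Unset Printing Implicit Defensive.

(** * Lebesgue measure on row vectors *)

Section rV_measure.
Context {R : realType}.
Implicit Types n : nat.

(** The order in which the parameters are fixed is what closes the limits. The times [t1 < t2] fix
    [M], and with it the Lipschitz constant [g (- M - 1)] of the modified H. Only then is a starting
    time [t'] in []0, t1[] chosen, with [u] at [t'] so close to [u0] in L^1 that the error stays
    small after multiplication by this constant. Taking [M] from [[t', t2]] would be circular; hence
    on [[t', t1]] the ratio of [g] composed with [m] to [g] along [u] has no lower bound independent
    of [t'], and only its sign is used there. As [t'] is positive, [u] is continuous on the compact
    product of the closure of Omega and [[t', t2]]; this gives one width [d] with H(u) <= kappa
    wherever phi_1 <= d, and the scale [e] of psi comes last. The gap between kappa and H(0) is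
    there because [u] may be slightly negative close to the boundary, where H(u) then exceeds
    H(0). *)

Lemma rV_cons_ord0 n a (v : 'rV[R]_n) : rV_cons (a, v) ord0 ord0 = a.
Proof. by have [] := rV_consK (a, v). Qed.

Lemma rV_cons_lift n a (v : 'rV[R]_n) j :
  rV_cons (a, v) ord0 (lift ord0 j) = v ord0 j.
Proof.
by have [_ /rowP/(_ j)] := rV_consK (a, v); rewrite mxE.
Qed.

Lemma ball_rVE n (c x : 'rV[R]_n) (r : R) :
  ball c r x <-> 0 < r /\ forall i, `|c ord0 i - x ord0 i| < r.
Proof.
split=> -[r0 H]; split=> //.
- by move=> i; exact: (H ord0 i).
- by move=> i j; rewrite (ord1 i); exact: H.
Qed.

Lemma ball_rV_bigcap n (c : 'rV[R]_n) (r : R) : 0 < r ->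
  ball c r = \bigcap_(i in [set: 'I_n])
    ((fun x : 'rV[R]_n => x ord0 i) @^-1` ball (c ord0 i) r).
Proof.
move=> r0; apply/seteqP; split=> x.
- by move/ball_rVE => [_ H] i _; exact: H.
- by move=> H; apply/ball_rVE; split=> // i; exact: H.
Qed.

Lemma measurable_ball_rV n (c : 'rV[R]_n) (r : R) : measurable (ball c r).
Proof.
have [r0|r0] := ltP 0 r; last first.
  rewrite (_ : ball c r = set0)//; apply/seteqP; split=> // x /ball_rVE[].
  by rewrite ltNge r0.
rewrite ball_rV_bigcap//; apply: fin_bigcap_measurable => [|i _].
  exact: finite_finset.
rewrite -[X in measurable X]setTI.
have mb := open_measurable (ball_open (c ord0 i) r).
exact: (measurable_coor (T := measurableTypeR R) i measurableT mb).
Qed.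

(** The sigma-algebra is generated by coordinates: an open set is a countable union of sup-norm
    balls with rational centres and radii [k.+1%:R^-1], and each ball is a finite intersection of
    coordinate preimages. *)
Lemma open_measurable_rV n (A : set 'rV[R]_n) : open A -> measurable A.
Proof.
move=> oA.
pose q (p : 'rV[rat]_n) : 'rV[R]_n := map_mx ratr p.
have -> : A = \bigcup_(p in [set: 'rV[rat]_n])
    \bigcup_(k in [set k | ball (q p) k.+1%:R^-1 `<=` A])
      ball (q p) k.+1%:R^-1.
  apply/seteqP; split; last by move=> x [p _ [k kA]]; exact: kA.
  move=> x Ax.
  have /nbhs_ballP[e /= e0 xeA] : nbhs x A by exact: open_nbhs_nbhs.
  (* The rational centre lies within [d] of [x] and the ball has radius [d], so [d < e / 2] keeps
     the ball inside [ball x e]. *)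
  pose k := Num.trunc (2 / e).
  have k1e : k.+1%:R^-1 < e / 2 :> R.
    rewrite -[ltRHS]invrK ltf_pV2 ?posrE ?invr_gt0 ?divr_gt0//.
    by rewrite invf_div truncnS_gt.
  set d := k.+1%:R^-1 in k1e.
  have d0 : 0 < d by rewrite invr_gt0.
  have H i : exists r : rat, `|ratr r - x ord0 i| < d :> R.
    have : x ord0 i - d < x ord0 i + d by rewrite ltrBlDr -addrA ltrDl addr_gt0.
    move=> /rat_in_itvoo[r]; rewrite in_itv/= => /andP[r1 r2].
    by exists r; rewrite ltr_distl r1.
  have [r rE] := choice H.
  exists (\row_i r i) => //.
  have qE i : q (\row_i r i) ord0 i = ratr (r i) by rewrite !mxE.
  exists k => /=; last first.
    by apply/ball_rVE; split=> [|i]; rewrite ?invr_gt0// qE.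
  move=> y /ball_rVE[_ Hy]; apply: xeA; apply/ball_rVE; split=> // i.
  have -> : x ord0 i - y ord0 i =
      (ratr (r i) - y ord0 i) - (ratr (r i) - x ord0 i) by ring.
  rewrite (le_lt_trans (ler_normB _ _))// [ltRHS]splitr ltrD//.
    by rewrite -qE (lt_trans (Hy i)).
  exact: lt_trans (rE i) _.
apply: countable_bigcupT_measurable => [|p].
  exact: countableP.
by apply: bigcup_measurable => k _; exact: measurable_ball_rV.
Qed.

Lemma continuous_measurable_rV n (A : set 'rV[R]_n) (f : 'rV[R]_n -> R) :
  open A -> {in A, continuous f} -> measurable_fun A f.
Proof.
move=> oA cf; apply: (measurability _ (RGenOpens.measurableE R)).
move=> _ [_ [a [b ->] <-]]; apply: open_measurable_rV.
by move/(continuous_inP f oA) : cf; apply; exact: interval_open.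
Qed.

(** Sup-norm balls are cubes, so each coordinate splits off a factor [2 * r]; in dimension 0 the
    Dirac mass supplies the empty product. *)
Lemma lebesgue_rV_ball n (c : 'rV[R]_n) (r : R) : 0 < r ->
  lebesgue_rV R n (ball c r) = ((2 * r) ^+ n)%:E.
Proof.
move=> r0; elim: n c => [|n IH] c.
  rewrite expr0 /= (_ : ball c r = setT) ?diracT//.
  by apply/seteqP; split=> // x _; apply/ball_rVE; split=> // -[].
rewrite /= /lebesgue_rV_cons /pushforward.
have -> : rV_cons (n:=n) @^-1` ball c r =
    ball (c ord0 ord0) r `*` ball ((rV_uncons c).2) r.
  apply/seteqP; split=> -[a v] /=.
  - move=> /ball_rVE[_ H]; split.
      by have := H ord0; rewrite rV_cons_ord0.
    by apply/ball_rVE; split=> // i; have := H (lift ord0 i);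
      rewrite rV_cons_lift mxE.
  - move=> [Ha /ball_rVE[_ Hv]]; apply/ball_rVE; split=> // i.
    have [k ->|->] := unliftP ord0 i; last by rewrite rV_cons_ord0.
    by have := Hv k; rewrite rV_cons_lift mxE.
rewrite product_measure1E; [|exact: measurable_ball|exact: measurable_ball_rV].
rewrite IH exprS EFinM; congr (_ * _)%E.
apply: etrans (lebesgue_measure_ball (c ord0 ord0) (ltW r0)) _.
by rewrite mulrC mulr_natr.
Qed.

Lemma bounded_lebesgue_rV n (A : set 'rV[R]_n) : measurable A ->
  bounded_set A -> (lebesgue_rV R n A < +oo)%E.
Proof.
move=> mA /ex_strict_bound_gt0[M M0 HM].
apply: (@le_lt_trans _ _ (lebesgue_rV R n (ball (0 : 'rV[R]_n) M))).
  apply: le_measure; rewrite ?inE//; first exact: measurable_ball_rV.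
  by move=> x /HM; rewrite -ball_normE/= sub0r normrN.
by rewrite lebesgue_rV_ball// ltry.
Qed.

Lemma integrable_rV_cons n (f : 'rV[R]_n.+1 -> \bar R) :
  (lebesgue_rV R n.+1).-integrable setT f ->
  (@lebesgue_measure R \x lebesgue_rV R n)%E.-integrable setT
    (f \o @rV_cons R n).
Proof.
move=> intf; have mf := measurable_int _ intf.
have mc : measurable_fun [set: (measurableTypeR R * 'rV[R]_n)%type]
  (@rV_cons R n) := @measurable_rV_cons R n.
apply/integrableP; split; first exact: measurableT_comp mf mc.
have /integrableP[_] := intf; apply: le_lt_trans.
rewrite [X in (_ <= X)%E](ge0_integral_pushforward mc
  (@lebesgue_measure R \x lebesgue_rV R n)%E)//.
exact: measurableT_comp.
Qed.

(** Moves integrals to a product measure, where Fubini applies. *)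
Lemma integral_rV_cons n (f : 'rV[R]_n.+1 -> \bar R) :
  (lebesgue_rV R n.+1).-integrable setT f ->
  (\int[lebesgue_rV R n.+1]_x f x =
   \int[@lebesgue_measure R \x lebesgue_rV R n]_p f (rV_cons p))%E.
Proof.
move=> intf; have mf := measurable_int _ intf.
have mc : measurable_fun [set: (measurableTypeR R * 'rV[R]_n)%type]
  (@rV_cons R n) := @measurable_rV_cons R n.
exact: (@integral_pushforward _ _ _ _ _ _ mc
  (@lebesgue_measure R \x lebesgue_rV R n)%E setT f mf
  (integrable_rV_cons intf) measurableT).
Qed.

End rV_measure.

(** * Integrals of partial derivatives *)

Section divergence.
Context {R : realType}.
Implicit Types n : nat.

Definition bounded_support n (f : 'rV[R]_n -> R) :=
  exists M : R, forall x, M <= `|x| -> f x = 0.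

Lemma continuous_bounded_supportW n (f : 'rV[R]_n -> R) :
  continuous f -> bounded_support f ->
  exists2 M : R, 0 < M & forall x, `|f x| <= M.
Proof.
move=> cf [M fM].
have cB : compact [set x : 'rV[R]_n | `|x| <= M].
  apply: bounded_closed_compact.
    exists M; split; first exact: num_real.
    by move=> r Mr x /= xM; rewrite (le_trans xM)// ltW.
  apply: (@closed_comp _ _ (fun x : 'rV[R]_n => `|x|) [set r | r <= M]).
    by move=> x _; exact: norm_continuous.
  exact: closed_le.
have /compact_bounded/ex_strict_bound_gt0[K K0 HK] :=
  continuous_compact (continuous_subspaceT cf) cB.
exists K => // x; have [Mx|xM] := leP M `|x|; first by rewrite fM// normr0 ltW.
by apply/ltW/HK; exists x => //=; exact: ltW.
Qed.

Lemma continuous_bounded_support_integrable n (f : 'rV[R]_n -> R) :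
  continuous f -> bounded_support f ->
  (lebesgue_rV R n).-integrable setT (EFin \o f).
Proof.
move=> cf bf; have [K K0 HK] := continuous_bounded_supportW cf bf.
case: bf => M fM.
have mf : measurable_fun setT f.
  by apply: continuous_measurable_rV => [|x _]; [exact: openT|exact: cf].
pose B := ball (0 : 'rV[R]_n) (`|M| + 1).
have M0 : 0 < `|M| + 1 by rewrite ltr_wpDl.
have fB : f = f \_ B.
  apply/funext => x; rewrite patchE; case: ifPn => // /negP xB.
  apply: fM; rewrite leNgt; apply/negP => xM; apply: xB; rewrite inE.
  rewrite /B -ball_normE /= sub0r normrN (lt_le_trans xM)//.
  by rewrite (le_trans (ler_norm _))// lerDl.
rewrite fB -restrict_EFin -integrable_mkcond; last exact: measurable_ball_rV.
apply: measurable_bounded_integrable.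
- exact: measurable_ball_rV.
- by have /= -> := lebesgue_rV_ball (0 : 'rV[R]_n) M0; rewrite ltry.
- exact: measurable_funTS.
- exists K; split; first exact: num_real.
  by move=> r Kr x _ /=; rewrite (le_trans (HK x))// ltW.
Qed.

Lemma derive_eq0_near n (f : 'rV[R]_n -> R) x v :
  (\forall y \near x, f y = 0) -> 'D_v f x = 0.
Proof.
move=> f0; rewrite (near_eq_derive (g := cst 0))//.
by rewrite derive_cst.
Qed.

Lemma bounded_support_derive n (f : 'rV[R]_n -> R) v :
  bounded_support f -> bounded_support ('D_v f).
Proof.
move=> [M fM]; exists (M + 1) => x Mx; apply: derive_eq0_near.
have : \forall y \near x, M < `|y|.
  have nx : (fun y : 'rV[R]_n => `|y|) @ x --> `|x| by exact: norm_continuous.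
  by apply: (cvgr_gt `|x| nx); rewrite (lt_le_trans _ Mx)// ltrDl.
by apply: filterS => y /ltW; exact: fM.
Qed.

(** A directional derivative only sees the restriction to a line. This transfers derivatives between
    a function and its slices, for Fubini, and between a function and its restriction to a line, for
    the chain rule. *)
Lemma derive_along_line (V W : normedModType R) (f : V -> R) (g : W -> R)
    x y v w : (forall h : R, f (h *: v + x) = g (h *: w + y)) ->
  'D_v f x = 'D_w g y /\ (derivable f x v -> derivable g y w).
Proof.
move=> fg; have fgE : (fun h : R => h^-1 *: ((f \o shift x) (h *: v) - f x)) =
    (fun h : R => h^-1 *: ((g \o shift y) (h *: w) - g y)).
  apply/funext => h /=; rewrite fg.
  by have := fg 0; rewrite !scale0r !add0r => ->.
by rewrite /derive /derivable fgE.
Qed.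

Lemma rV_cons_shift0 n (h a : R) (v : 'rV[R]_n) :
  h *: base_rV R ord0 + rV_cons (a, v) = rV_cons (h + a, v).
Proof.
apply/rowP => i; rewrite [LHS]mxE [X in X + _]mxE [X in _ * X + _]mxE.
have [k ->|->] := unliftP ord0 i.
  by rewrite !rV_cons_lift mulr0 add0r.
by rewrite !rV_cons_ord0 eqxx mulr1.
Qed.

Lemma rV_cons_shiftS n (h a : R) (v : 'rV[R]_n) j :
  h *: base_rV R (lift ord0 j) + rV_cons (a, v) =
  rV_cons (a, h *: base_rV R j + v).
Proof.
apply/rowP => i; rewrite [LHS]mxE [X in X + _]mxE [X in _ * X + _]mxE.
have [k ->|->] := unliftP ord0 i.
  by rewrite !rV_cons_lift !mxE (inj_eq lift_inj).
by rewrite !rV_cons_ord0 mulr0 add0r.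
Qed.

Lemma rV_consl_continuous n (v : 'rV[R]_n) :
  continuous (fun a : R => rV_cons (a, v)).
Proof.
move=> a; apply/cvg_ballP => e e0; near=> b.
apply/ball_rVE; split=> // i; have [k ->|->] := unliftP ord0 i.
  by rewrite !rV_cons_lift subrr normr0.
rewrite !rV_cons_ord0; near: b.
exact: (@cvgr_dist_lt _ _ _ (nbhs a) _ id a).
Unshelve. all: by end_near. Qed.

Lemma rV_consr_continuous n (a : R) :
  continuous (fun v : 'rV[R]_n => rV_cons (a, v)).
Proof.
move=> v; apply: (iffRL (@cvg_ballP _ _ _ (nbhs v) _ (fun w => rV_cons (a, w))
  (rV_cons (a, v)))) => e e0.
have : \forall w \near v, ball v e w by exact: nbhsx_ballx.
apply: filterS => w /ball_rVE[_ vw].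
apply/ball_rVE; split=> // i; have [k ->|->] := unliftP ord0 i.
  by rewrite !rV_cons_lift.
by rewrite !rV_cons_ord0 subrr normr0.
Qed.

Lemma normr_coor n (x : 'rV[R]_n) i : `|x ord0 i| <= `|x|.
Proof.
rewrite [leRHS]/Num.norm /= mx_normrE.
by apply: (le_bigmax _ (fun ij => `|x ij.1 ij.2|) (ord0, i)).
Qed.

Lemma normr_rV_le n (x : 'rV[R]_n) (r : R) : 0 <= r ->
  (forall i, `|x ord0 i| <= r) -> `|x| <= r.
Proof.
move=> r0 H; rewrite [leLHS]/Num.norm /= mx_normrE.
by apply: bigmax_le => // -[i j] _ /=; rewrite (ord1 i).
Qed.

Lemma rV_cons_norml n a (v : 'rV[R]_n) : `|a| <= `|rV_cons (a, v)|.
Proof. by have := normr_coor (rV_cons (a, v)) ord0; rewrite rV_cons_ord0. Qed.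

Lemma rV_cons_normr n a (v : 'rV[R]_n) : `|v| <= `|rV_cons (a, v)|.
Proof.
apply: normr_rV_le => // i.
by have := normr_coor (rV_cons (a, v)) (lift ord0 i); rewrite rV_cons_lift.
Qed.

Lemma integral_derive1_eq0 (F : R -> R) (M : R) :
  (forall x, M <= `|x| -> F x = 0) -> (forall x, derivable F x 1) ->
  continuous F^`()%classic -> (\int[lebesgue_measure]_x (F^`()%classic x)%:E = 0)%E.
Proof.
move=> FM dF cF.
(* [K] exceeds [M] strictly, so [F] vanishes in a neighbourhood of every point with [K <= |x|] and
   its derivative vanishes there too. *)
pose K := `|M| + 1; have K0 : 0 < K by rewrite ltr_wpDl.
have MK : M < K by rewrite (le_lt_trans (ler_norm _))// ltrDl.
have F'0 x : K <= `|x| -> F^`()%classic x = 0.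
  move=> Kx; rewrite derive1E (near_eq_derive (g := cst 0)) ?derive_cst//.
  have : \forall y \near x, M < `|y|.
    have nx : (fun y : R => `|y|) @ x --> `|x| by exact: norm_continuous.
    by apply: (cvgr_gt `|x| nx); exact: lt_le_trans Kx.
  by apply: filterS => y /ltW; exact: FM.
have -> : (\int[lebesgue_measure]_x (F^`()%classic x)%:E =
    \int[lebesgue_measure]_(x in `[(- K)%R, K]) (F^`()%classic x)%:E)%E.
  rewrite [RHS]integral_mkcond; apply: eq_integral => x _.
  rewrite patchE; case: ifPn => // /negP; rewrite inE/= in_itv/= => /negP xK.
  by rewrite F'0// leNgt; apply: contra xK => /ltW; rewrite ler_norml.
have NKK : - K < K by rewrite (lt_trans _ K0)// oppr_lt0.
rewrite (@continuous_FTC2 _ _ F)//.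
- by rewrite !FM ?subee// ?normrN gtr0_norm// ltW.
- by apply: continuous_subspaceT => x; exact: cF.
- have cFx x : {for x, continuous F}.
    by apply: differentiable_continuous; exact/derivable1_diffP.
  split=> [x _||].
  + exact: dF.
  + by apply: cvg_at_right_filter; exact: cFx.
  + by apply: cvg_at_left_filter; exact: cFx.
Qed.

(** Induction on the dimension by Fubini. If [i] is the first coordinate, the inner integral runs
    over it and the one-variable case gives 0; otherwise the first coordinate is frozen and the
    induction hypothesis applies to the slice. *)
Lemma integral_derive_eq0 n (F : 'rV[R]_n -> R) (i : 'I_n) :
  bounded_support F -> (forall x, derivable F x (base_rV R i)) ->
  continuous ('D_(base_rV R i) F) ->
  (\int[lebesgue_rV R n]_x ('D_(base_rV R i) F x)%:E = 0)%E.
Proof.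
elim: n F i => [F [] //|n IH] F i [M FM] dF cF.
have iF : (lebesgue_rV R n.+1).-integrable setT (EFin \o 'D_(base_rV R i) F).
  apply: continuous_bounded_support_integrable => //.
  by apply: bounded_support_derive; exists M.
rewrite integral_rV_cons//; have iFc := integrable_rV_cons iF.
have [j ij|i0] := unliftP ord0 i.
- rewrite -(integral12_prod_meas1 iFc) /fubini_F.
  rewrite integral0_eq// => a _.
  have FE v := derive_along_line (V := 'rV[R]_n.+1) (W := 'rV[R]_n)
    (f := F) (g := fun w => F (rV_cons (a, w))) (x := rV_cons (a, v)) (y := v)
    (fun h => congr1 F (rV_cons_shiftS h a v j)).
  rewrite ij; under eq_integral do rewrite /= (FE _).1.
  apply: IH.
  + by exists M => v Mv; apply: FM; rewrite (le_trans Mv)// rV_cons_normr.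
  + by move=> v; apply: (FE v).2; rewrite -ij; exact: dF.
  + rewrite (_ : 'D__ _ = 'D_(base_rV R i) F \o (fun w => rV_cons (a, w))).
      move=> w.
      exact: (continuous_comp (@rV_consr_continuous n a w) (cF _)).
    by apply/funext => w /=; rewrite ij (FE w).1.
- rewrite -(integral21_prod_meas1 iFc) /fubini_G.
  rewrite integral0_eq// => v _.
  have shE (h b : R) : F (h *: base_rV R ord0 + rV_cons (b, v)) =
      F (rV_cons (h *: 1 + b, v)) by rewrite rV_cons_shift0 [h%:A]mulr1.
  have FE b := derive_along_line (V := 'rV[R]_n.+1) (W := R)
    (f := F) (g := fun b => F (rV_cons (b, v))) (x := rV_cons (b, v)) (y := b)
    (fun h => shE h b).
  rewrite i0; under eq_integral do rewrite /= (FE _).1 -derive1E.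
  apply: (@integral_derive1_eq0 _ M).
  + by move=> a Ma; apply: FM; rewrite (le_trans Ma)// rV_cons_norml.
  + by move=> a; apply: (FE a).2; rewrite -i0; exact: dF.
  + rewrite (_ : _^`()%classic = 'D_(base_rV R i) F \o (fun b => rV_cons (b, v))).
      move=> w.
      exact: (continuous_comp (@rV_consl_continuous n v w) (cF _)).
    by apply/funext => w /=; rewrite i0 derive1E (FE w).1.
Qed.

End divergence.

(** * Chain rule and Green's identity *)

Section chain_rule.
Context {R : realType}.

(** Restricting to the line through [x] in direction [e] leaves the one-variable chain rule, so a
    directional derivative of [v] is enough. *)
Lemma is_derive_comp_dir (V : normedModType R) (v : V -> R) (th : R -> R)
    (x e : V) (d : R) :
  derivable v x e -> is_derive (v x) 1 th d ->
  is_derive x e (th \o v) (d * 'D_e v x).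
Proof.
move=> dv [dth thE]; pose g (h : R) := v (h *: e + x).
have shE (h : R) : g (h *: 1 + 0) = v (h *: e + x).
  by rewrite /g addr0 [h%:A]mulr1.
have [vE dvg] := derive_along_line (V := V) (W := R) (f := v) (g := g)
  (fun h => esym (shE h)).
have shE' (h : R) : (th \o g) (h *: 1 + 0) = (th \o v) (h *: e + x).
  by rewrite /= shE.
have [thvE dthg] := derive_along_line (V := R) (W := V) (f := th \o g)
  (g := th \o v) shE'.
have g0 : v x = g 0 by rewrite /g scale0r add0r.
have dgv : is_derive (0 : R) 1 g ('D_e v x).
  by apply: DeriveDef; [exact: dvg|exact: esym vE].
have dth' : is_derive (g 0) 1 th d by rewrite -g0; exact: DeriveDef.
have [dthg0 thgE] := @is_derive1_comp _ th g 0 d ('D_e v x) dth' dgv.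
by apply: DeriveDef; [exact: dthg|rewrite -thvE thgE].
Qed.

End chain_rule.

Section continuous_at.
Context {R : realType} {T : topologicalType}.
Implicit Types (f g : T -> R) (x : T).

Lemma continuous_at_sum n (F : 'I_n -> T -> R) x :
  (forall i, {for x, continuous (F i)}) ->
  {for x, continuous (fun y => \sum_(i < n) F i y)}.
Proof. by move=> cF; apply: cvg_big => [|i _]; [exact: add_continuous|exact: cF]. Qed.

Lemma continuous_atM f g x : {for x, continuous f} -> {for x, continuous g} ->
  {for x, continuous (fun y => f y * g y)}.
Proof. by move=> cf cg; exact: cvgM. Qed.

Lemma continuous_atD f g x : {for x, continuous f} -> {for x, continuous g} ->
  {for x, continuous (fun y => f y + g y)}.
Proof. by move=> cf cg; exact: cvgD. Qed.

Lemma continuous_atB f g x : {for x, continuous f} -> {for x, continuous g} ->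
  {for x, continuous (fun y => f y - g y)}.
Proof. by move=> cf cg; exact: cvgB. Qed.

Lemma near_eq_continuous_at f g x : {near x, f =1 g} ->
  {for x, continuous f} -> {for x, continuous g}.
Proof.
move=> fg cf; rewrite /prop_for /continuous_at -(nbhs_singleton fg).
exact: cvg_trans (near_eq_cvg fg) cf.
Qed.

End continuous_at.

(** * Functions supported inside the domain, and Green's identity *)

Section vanishing.
Context {R : realType} {n : nat} (Omega : set 'rV[R]_n).
Hypotheses (oO : open Omega) (bO : bounded_set Omega).
Implicit Types v w : 'rV[R]_n -> R.

(** The closed support of [w] lies in [Omega], in a form that passes directly to derivatives and to
    products. *)
Definition vanishes_off w := forall x, ~ Omega x -> \forall y \near x, w y = 0.

(** The regularity that the Laplacian sees, one direction at a time; it is stable under composition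
    with functions of one variable. *)
Definition pure_C2 v := forall x, Omega x -> {for x, continuous v} /\
  forall i, [/\ derivable v x (base_rV R i),
      {for x, continuous ('D_(base_rV R i) v)},
      derivable ('D_(base_rV R i) v) x (base_rV R i) &
      {for x, continuous ('D_(base_rV R i) ('D_(base_rV R i) v))}].

Lemma vanishes_off_eq0 w x : vanishes_off w -> ~ Omega x -> w x = 0.
Proof. by move=> vw Ox; have := vw x Ox => /nbhs_singleton. Qed.

Lemma vanishes_offMr v w : vanishes_off w -> vanishes_off (fun x => v x * w x).
Proof.
by move=> vw x /vw; apply: filterS => y ->; rewrite mulr0.
Qed.

Lemma vanishes_offD v w : vanishes_off v -> vanishes_off w ->
  vanishes_off (fun x => v x + w x).
Proof.
move=> vv vw x Ox; near=> y.
have -> : v y = 0 by near: y; exact: vv.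
by rewrite add0r; near: y; exact: vw.
Unshelve. all: by end_near. Qed.

Lemma vanishes_offN v : vanishes_off v -> vanishes_off (fun x => - v x).
Proof. by move=> vw x /vw; apply: filterS => y ->; rewrite oppr0. Qed.

Lemma vanishes_off_derive w e : vanishes_off w -> vanishes_off ('D_e w).
Proof.
move=> vw x /vw /near_join; apply: filterS => y; exact: derive_eq0_near.
Qed.

Lemma vanishes_off_laplacian w : vanishes_off w -> vanishes_off (laplacian w).
Proof.
move=> vw x /vw /near_join; apply: filterS => y /near_join wy.
rewrite /laplacian big1// => i _; apply: derive_eq0_near.
by apply: filterS wy => z; exact: derive_eq0_near.
Qed.

Lemma vanishes_off_continuous w : (forall x, Omega x -> {for x, continuous w}) ->
  vanishes_off w -> continuous w.
Proof.
move=> cw vw x; have [Ox|Ox] := pselect (Omega x); first exact: cw.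
have w0 : {near x, cst 0 =1 w} by apply: filterS (vw x Ox) => y ->.
by apply: near_eq_continuous_at w0 _; exact: cst_continuous.
Qed.

Lemma vanishes_off_derivable w e : (forall x, Omega x -> derivable w x e) ->
  vanishes_off w -> forall x, derivable w x e.
Proof.
move=> dw vw x; have [Ox|Ox] := pselect (Omega x); first exact: dw.
apply: (@near_eq_derivable _ _ _ (cst 0)); last exact: derivable_cst.
by apply: filterS (vw x Ox) => y ->.
Qed.

Lemma vanishes_off_bounded_support w : vanishes_off w -> bounded_support w.
Proof.
move=> vw; have /ex_strict_bound_gt0[M M0 HM] := bO.
exists M => x Mx; apply: vanishes_off_eq0 => // Ox.
by have := HM x Ox; rewrite /= ltNge Mx.
Qed.

Lemma vanishes_off_integrableT w : (forall x, Omega x -> {for x, continuous w}) ->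
  vanishes_off w -> (lebesgue_rV R n).-integrable setT (EFin \o w).
Proof.
move=> cw vw; apply: continuous_bounded_support_integrable.
  exact: vanishes_off_continuous.
exact: vanishes_off_bounded_support.
Qed.

Lemma vanishes_off_integrable w : (forall x, Omega x -> {for x, continuous w}) ->
  vanishes_off w -> (lebesgue_rV R n).-integrable Omega (EFin \o w).
Proof.
move=> cw vw; apply: (@integrableS _ _ _ _ setT) => //.
  exact: open_measurable_rV.
exact: vanishes_off_integrableT.
Qed.

Lemma vanishes_off_integral w : vanishes_off w ->
  (\int[lebesgue_rV R n]_(x in Omega) (w x)%:E =
   \int[lebesgue_rV R n]_x (w x)%:E)%E.
Proof.
move=> vw; rewrite integral_mkcond; apply: eq_integral => x _.
rewrite patchE; case: ifPn => // /negP; rewrite inE => Ox.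
by rewrite vanishes_off_eq0.
Qed.

Lemma pure_C2_laplacian_continuous v x : pure_C2 v -> Omega x ->
  {for x, continuous (laplacian v)}.
Proof.
move=> cv Ox; apply: continuous_at_sum => i; by have [_ /(_ i)[]] := cv x Ox.
Qed.

Lemma green_integrand_continuous v w : pure_C2 v -> pure_C2 w ->
  forall x, Omega x ->
  {for x, continuous (fun y => laplacian v y * w y - v y * laplacian w y)}.
Proof.
move=> cv cw x Ox.
have [c1 _] := cv x Ox; have [c2 _] := cw x Ox.
by apply: continuous_atB; apply: continuous_atM => //;
  exact: (pure_C2_laplacian_continuous _ Ox).
Qed.

(** The integrand is the divergence of the field [F], which vanishes near every point off [Omega].
    Each partial derivative can thus be integrated over the whole space, where it gives 0, and no
    boundary term arises. *)
Lemma green_identity v w : pure_C2 v -> pure_C2 w -> vanishes_off w ->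
  \int[lebesgue_rV R n]_(x in Omega)
    (laplacian v x * w x - v x * laplacian w x) = 0.
Proof.
move=> cv cw vw.
pose F i := (fun x => 'D_(base_rV R i) v x * w x) -
            (fun x => v x * 'D_(base_rV R i) w x).
have vF i : vanishes_off (F i).
  by apply: vanishes_offD; [exact: vanishes_offMr|
    apply/vanishes_offN/vanishes_offMr/vanishes_off_derive].
have isF i x : Omega x -> is_derive x (base_rV R i) (F i)
    ('D_(base_rV R i) ('D_(base_rV R i) v) x * w x -
     v x * 'D_(base_rV R i) ('D_(base_rV R i) w) x).
  move=> Ox; have [_ /(_ i)[dv _ ddv _]] := cv x Ox.
  have [_ /(_ i)[dw _ ddw _]] := cw x Ox.
  have := is_deriveB (is_deriveM (derivableP ddv) (derivableP dw))
             (is_deriveM (derivableP dv) (derivableP ddw)).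
  move=> /is_derive_eq; apply.
  rewrite /GRing.scale/=.
  move: ('D_(base_rV R i) ('D_(base_rV R i) v) x)
    ('D_(base_rV R i) ('D_(base_rV R i) w) x) => a b.
  by move: ('D_(base_rV R i) v x) ('D_(base_rV R i) w x) (v x) (w x) => *; ring.
have dF i x : derivable (F i) x (base_rV R i).
  by apply: vanishes_off_derivable => // y Oy; have [] := isF i y Oy.
have DFE i x : Omega x -> 'D_(base_rV R i) (F i) x =
    'D_(base_rV R i) ('D_(base_rV R i) v) x * w x -
     v x * 'D_(base_rV R i) ('D_(base_rV R i) w) x.
  by move=> Ox; have [_ ->] := isF i x Ox.
have cDF i x : Omega x -> {for x, continuous ('D_(base_rV R i) (F i))}.
  move=> Ox; have : {near x, (fun y => 'D_(base_rV R i) ('D_(base_rV R i) v) y * w y -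
     v y * 'D_(base_rV R i) ('D_(base_rV R i) w) y) =1 'D_(base_rV R i) (F i)}.
    by apply: filterS (open_nbhs_nbhs (conj oO Ox)) => y Oy; rewrite DFE.
  move=> /near_eq_continuous_at; apply.
  have [c1 /(_ i)[_ _ _ c2]] := cv x Ox.
  have [c3 /(_ i)[_ _ _ c4]] := cw x Ox.
  exact: (continuous_atB (continuous_atM c2 c3) (continuous_atM c1 c4)).
rewrite /Rintegral.
rewrite (eq_integral (fun x => (\sum_(i < n) 'D_(base_rV R i) (F i) x)%:E)); last first.
  move=> x /[!inE] Ox; congr EFin; rewrite /laplacian mulr_suml mulr_sumr -sumrB.
  by apply: eq_bigr => i _; rewrite DFE.
under eq_integral do rewrite -sumEFin.
rewrite integral_sum.
- rewrite big1//= => i _; rewrite vanishes_off_integral; last exact: vanishes_off_derive.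
  rewrite integral_derive_eq0//; first exact: vanishes_off_bounded_support.
  by apply: vanishes_off_continuous; [exact: cDF|exact: vanishes_off_derive].
- exact: open_measurable_rV.
- move=> i; apply: vanishes_off_integrable; first exact: cDF.
  exact: vanishes_off_derive.
Qed.

(** Smoothness of [th] is asked only on [S] because [H_of G] is differentiable only below 1. The
    function [W] agrees with [th \o v] only inside [Omega] so as to cover the cut eigenfunction,
    which is extended by zero. *)
Lemma pure_C2_comp v W (th th1 th2 : R -> R) (S : set R) :
  pure_C2 v -> (forall x, Omega x -> S (v x)) ->
  (forall x, Omega x -> W x = th (v x)) ->
  (forall s, S s -> is_derive s 1 th (th1 s)) ->
  (forall s, S s -> is_derive s 1 th1 (th2 s)) ->
  (forall s, S s -> {for s, continuous th2}) ->
  pure_C2 W /\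
  forall x, Omega x -> laplacian W x =
    th2 (v x) * (\sum_(i < n) 'D_(base_rV R i) v x ^+ 2) +
    th1 (v x) * laplacian v x.
Proof.
move=> cv vS WE dth dth1 cth2.
have cth s : S s -> {for s, continuous th}.
  by move=> /dth[d _]; apply: differentiable_continuous; exact/derivable1_diffP.
have cth1 s : S s -> {for s, continuous th1}.
  by move=> /dth1[d _]; apply: differentiable_continuous; exact/derivable1_diffP.
have WE' x : Omega x -> {near x, th \o v =1 W}.
  move=> Ox; apply: filterS (open_nbhs_nbhs (conj oO Ox)) => y Oy.
  by rewrite WE.
have D1 i x : Omega x -> is_derive x (base_rV R i) W
    (th1 (v x) * 'D_(base_rV R i) v x).
  move=> Ox; have [_ /(_ i)[dv _ _ _]] := cv x Ox.
  exact: near_eq_is_derive (WE' x Ox) (is_derive_comp_dir dv (dth _ (vS x Ox))).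
have D1E i x : Omega x ->
    {near x, (fun y => th1 (v y) * 'D_(base_rV R i) v y) =1
       'D_(base_rV R i) W}.
  move=> Ox; apply: filterS (open_nbhs_nbhs (conj oO Ox)) => y Oy.
  by have [_ ->] := D1 i y Oy.
have D2 i x : Omega x -> is_derive x (base_rV R i) ('D_(base_rV R i) W)
    (th2 (v x) * 'D_(base_rV R i) v x ^+ 2 +
     th1 (v x) * 'D_(base_rV R i) ('D_(base_rV R i) v) x).
  move=> Ox; have [_ /(_ i)[dv _ ddv _]] := cv x Ox.
  apply: (near_eq_is_derive (D1E i x Ox)).
  have := is_deriveM (is_derive_comp_dir dv (dth1 _ (vS x Ox))) (derivableP ddv).
  move=> /is_derive_eq; apply.
  rewrite /GRing.scale/=; move: ('D_(base_rV R i) ('D_(base_rV R i) v) x) => a.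
  by move: ('D_(base_rV R i) v x) (th1 (v x)) (th2 (v x)) => *; ring.
have D2E i x : Omega x ->
    {near x, (fun y => th2 (v y) * 'D_(base_rV R i) v y ^+ 2 +
       th1 (v y) * 'D_(base_rV R i) ('D_(base_rV R i) v) y) =1
     'D_(base_rV R i) ('D_(base_rV R i) W)}.
  move=> Ox; apply: filterS (open_nbhs_nbhs (conj oO Ox)) => y Oy.
  by have [_ ->] := D2 i y Oy.
split=> [x Ox|x Ox]; last first.
  rewrite /laplacian !mulr_sumr -big_split/=.
  by apply: eq_bigr => i _; have [_ ->] := D2 i x Ox.
have [c0 c0i] := cv x Ox; have Sx := vS x Ox.
have cthv : {for x, continuous (th1 \o v)} by exact: (continuous_comp c0 (cth1 _ Sx)).
have cth2v : {for x, continuous (th2 \o v)} by exact: (continuous_comp c0 (cth2 _ Sx)).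
split.
  by apply: near_eq_continuous_at (WE' x Ox) _; exact: (continuous_comp c0 (cth _ Sx)).
move=> i; have [dv c1 ddv c2] := c0i i; split.
- by have [] := D1 i x Ox.
- by apply: near_eq_continuous_at (D1E i x Ox) _; exact: (continuous_atM cthv c1).
- by have [] := D2 i x Ox.
- apply: near_eq_continuous_at (D2E i x Ox) _.
  exact: (continuous_atD (continuous_atM cth2v (continuous_atM c1 c1))
    (continuous_atM cthv c2)).
Qed.

End vanishing.

(** * Cut-off functions and tail integrals *)

Section positive_power.
Context {R : realType}.
Implicit Types (x e : R) (k : nat).

Definition pospow k x : R := Num.max x 0 ^+ k.

Lemma pospow_ge0 k x : 0 <= x -> pospow k x = x ^+ k.
Proof. by move=> x0; rewrite /pospow max_l. Qed.

Lemma pospow_le0 k x : x <= 0 -> pospow k.+1 x = 0.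
Proof. by move=> x0; rewrite /pospow max_r// expr0n. Qed.

Lemma pospow_continuous k : continuous (pospow k).
Proof.
move=> x.
have cmax : {for x, continuous (fun y : R => Num.max y 0)}.
  exact: (@continuous_max _ _ id (cst 0) x (@cvg_id _ (nbhs x))
    (@cst_continuous _ _ _ x)).
exact: (continuous_comp cmax (@exprn_continuous R k _)).
Qed.

Lemma is_derive_pospow k x :
  is_derive x 1 (pospow k.+2) (k.+2%:R * pospow k.+1 x).
Proof.
have [x0|x0|->] := ltgtP x 0.
- rewrite pospow_le0 ?ltW// mulr0.
  apply: (@near_eq_is_derive _ _ _ (cst 0)).
  near=> y; rewrite pospow_le0//; near: y.
  exact: (filterS (fun y => @ltW _ _ y 0) (lt_nbhsl x0)).
- rewrite pospow_ge0 ?ltW//.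
  have dX : is_derive x 1 (fun y : R => y ^+ k.+2) (k.+2%:R * x ^+ k.+1).
    apply: DeriveDef; first exact: exprn_derivable.
    by rewrite exp_derive /GRing.scale/= mulr1.
  apply: near_eq_is_derive dX.
  near=> y; rewrite pospow_ge0//; near: y.
  exact: (filterS (fun y => @ltW _ _ 0 y) (lt_nbhsr x0)).
- rewrite pospow_le0// mulr0.
  (* At the kink the difference quotient of [pospow k.+2] is [pospow k.+1 h], which tends to 0. *)
  have : h^-1 *: ((pospow k.+2 \o shift 0) (h *: 1) - pospow k.+2 0)
      @[h --> 0^'] --> (0 : R).
    have c0 : pospow k.+1 h @[h --> 0^'] --> pospow k.+1 0.
      exact: cvg_within_filter (@pospow_continuous k.+1 0).
    rewrite pospow_le0// in c0; apply: cvg_trans c0; apply: near_eq_cvg.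
    near=> h; rewrite /= addr0 [h%:A]mulr1 (pospow_le0 _ (lexx 0)) subr0.
    have h0 : h != 0 by near: h; exact: nbhs_dnbhs_neq.
    rewrite /GRing.scale/=; case: (ltgtP h 0) h0 => // h0 _.
      by rewrite !pospow_le0 ?mulr0// ltW.
    by rewrite !pospow_ge0 ?ltW// [in RHS]exprS mulKf// gt_eqF.
  by move=> H; apply: DeriveDef; [apply/cvg_ex; exists 0|exact/cvg_lim].
Unshelve. all: by end_near. Qed.

Lemma is_derive_add (f g : R -> R) x a b : is_derive x 1 f a ->
  is_derive x 1 g b -> is_derive x 1 (fun y => f y + g y) (a + b).
Proof. by move=> df dg; exact: is_deriveD. Qed.

Lemma is_derive_sub (f g : R -> R) x a b : is_derive x 1 f a ->
  is_derive x 1 g b -> is_derive x 1 (fun y => f y - g y) (a - b).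
Proof. by move=> df dg; exact: is_deriveB. Qed.

Lemma is_derive_mull c (f : R -> R) x a : is_derive x 1 f a ->
  is_derive x 1 (fun y => c * f y) (c * a).
Proof. by move=> df; exact: is_deriveZ. Qed.

Lemma is_derive_mulr c (f : R -> R) x a : is_derive x 1 f a ->
  is_derive x 1 (fun y => f y * c) (a * c).
Proof.
by move=> df; under eq_fun do rewrite mulrC; rewrite mulrC; exact: is_derive_mull.
Qed.

Lemma is_derive_affine (F : R -> R) a b x d :
  is_derive (a * x + b) 1 F d ->
  is_derive x 1 (fun y => F (a * y + b)) (a * d).
Proof.
move=> dF.
have dv : is_derive x 1 (fun y : R => a * y + b) a.
  rewrite -[X in is_derive _ _ _ X]addr0 -[X in X + 0]mulr1.
  exact: is_derive_add (is_derive_mull a (is_derive_id x _)) (is_derive_cst b x _).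
case: dv => dv vE.
by have := is_derive_comp_dir dv dF; rewrite vE mulrC.
Qed.

End positive_power.

(** * Explicit piecewise polynomial cut-offs *)

Section cutoffs.
Context {R : realType}.
Implicit Types (x z e s M : R).

(* [ramp2] is the hat function with support [0, 2] and integral 1, and [ramp]
   is its second antiderivative. *)
Definition ramp z : R :=
  (pospow 3 z - 2 * pospow 3 (z - 1) + pospow 3 (z - 2)) / 6.
Definition ramp1 z : R :=
  (pospow 2 z - 2 * pospow 2 (z - 1) + pospow 2 (z - 2)) / 2.
Definition ramp2 z : R :=
  pospow 1 z - 2 * pospow 1 (z - 1) + pospow 1 (z - 2).

Lemma is_derive_ramp z : is_derive z 1 ramp (ramp1 z).
Proof.
have d0 b : is_derive z 1 (fun y : R => pospow 3 (y - b)) (3 * pospow 2 (z - b)).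
  have := @is_derive_affine _ (pospow 3) 1 (- b) z _ (is_derive_pospow _ _).
  by under eq_fun do rewrite mul1r; rewrite !mul1r.
have := is_derive_mulr 6^-1 (is_derive_add (is_derive_sub (is_derive_pospow 1 z)
  (is_derive_mull 2 (d0 1))) (d0 2)).
by move=> /is_derive_eq; apply; rewrite /ramp1; field.
Qed.

Lemma is_derive_ramp1 z : is_derive z 1 ramp1 (ramp2 z).
Proof.
have d0 b : is_derive z 1 (fun y : R => pospow 2 (y - b)) (2 * pospow 1 (z - b)).
  have := @is_derive_affine _ (pospow 2) 1 (- b) z _ (is_derive_pospow _ _).
  by under eq_fun do rewrite mul1r; rewrite !mul1r.
have := is_derive_mulr 2^-1 (is_derive_add (is_derive_sub (is_derive_pospow 0 z)
  (is_derive_mull 2 (d0 1))) (d0 2)).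
by move=> /is_derive_eq; apply; rewrite /ramp2; field.
Qed.

Lemma affine_continuous (a b : R) : continuous (fun z : R => a * z + b).
Proof.
move=> z; have H := continuous_atM (@cst_continuous R R a z) (@cvg_id _ (nbhs z)).
exact: (continuous_atD H (@cst_continuous R R b z)).
Qed.

Lemma pospow_affine_continuous k (a b : R) :
  continuous (fun z : R => pospow k (a * z + b)).
Proof.
move=> z; exact: (continuous_comp (@affine_continuous a b z)
  (@pospow_continuous R k _)).
Qed.

Lemma ramp2_continuous : continuous ramp2.
Proof.
have c b z : {for z, continuous (fun z : R => pospow 1 (z - b))}.
  have := @pospow_affine_continuous 1 1 (- b) z.
  by under eq_fun do rewrite mul1r.
move=> z; have H := continuous_atB (@pospow_continuous R 1 z)
  (continuous_atM (@cst_continuous R R 2 z) (c 1 z)).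
exact: (continuous_atD H (c 2 z)).
Qed.

(** The hat function has mass 1 and barycentre 1, so the ramp equals [z - 1] from [z = 2] on; by
    convexity this line bounds it from below everywhere. *)
Lemma ramp_bounds z : [/\ z <= 0 -> ramp z = 0, 0 <= ramp z,
  z - 1 <= ramp z & 0 <= z -> ramp z <= z].
Proof.
rewrite /ramp.
have [z0|z0] := leP z 0; first by rewrite !pospow_le0; try lra; split => *; lra.
rewrite (pospow_ge0 _ (ltW z0)).
have [z1|z1] := leP z 1; first by rewrite !pospow_le0; try lra; split => *; nra.
rewrite (@pospow_ge0 _ _ (z - 1)); last by lra.
have [z2|z2] := leP z 2.
  rewrite pospow_le0; last by lra.
  have -> : z ^+ 3 - 2 * (z - 1) ^+ 3 + 0 = 6 * (z - 1) + (2 - z) ^+ 3 by ring.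
  have t0 : 0 <= (2 - z) ^+ 3 by rewrite exprn_ge0//; lra.
  have t1 : (2 - z) ^+ 3 <= 1 by rewrite exprn_ile1//; lra.
  by split => *; lra.
rewrite pospow_ge0; last by lra.
have -> : z ^+ 3 - 2 * (z - 1) ^+ 3 + (z - 2) ^+ 3 = 6 * (z - 1) by ring.
by split => *; lra.
Qed.

Lemma ramp1_bounds z : 0 <= ramp1 z <= 1.
Proof.
rewrite /ramp1.
have [z0|z0] := leP z 0; first by rewrite !pospow_le0; try lra.
rewrite (pospow_ge0 _ (ltW z0)).
have [z1|z1] := leP z 1.
  by rewrite !pospow_le0; try lra; apply/andP; split; nra.
rewrite (@pospow_ge0 _ _ (z - 1)); last by lra.
have [z2|z2] := leP z 2.
  by rewrite pospow_le0; try lra; apply/andP; split; nra.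
by rewrite pospow_ge0; try lra; apply/andP; split; nra.
Qed.

Lemma ramp2_bounds z : 0 <= ramp2 z /\ (2 <= z -> ramp2 z = 0).
Proof.
rewrite /ramp2.
have [z0|z0] := leP z 0; first by rewrite !pospow_le0; try lra; split=> *; lra.
rewrite (pospow_ge0 _ (ltW z0)) expr1.
have [z1|z1] := leP z 1; first by rewrite !pospow_le0; try lra; split=> *; lra.
rewrite (@pospow_ge0 _ _ (z - 1)) ?expr1; last by lra.
have [z2|z2] := leP z 2; first by rewrite pospow_le0; try lra; split=> *; lra.
by rewrite pospow_ge0 ?expr1; try lra; split=> *; lra.
Qed.

(** The psi of the overview at scale [e]. The shift by 1 makes it vanish on [s <= e], a full
    neighbourhood of 0; from [3 * e] on it equals [s - 2 * e]. *)
Definition smooth_cut e s : R := e * ramp (e^-1 * s + (- 1)).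
Definition smooth_cut1 e s : R := ramp1 (e^-1 * s + (- 1)).
Definition smooth_cut2 e s : R := e^-1 * ramp2 (e^-1 * s + (- 1)).

Lemma is_derive_smooth_cut e s : 0 < e ->
  is_derive s 1 (smooth_cut e) (smooth_cut1 e s).
Proof.
move=> e0; have := is_derive_mull e (is_derive_affine
  (is_derive_ramp (e^-1 * s + (- 1)))).
by move=> /is_derive_eq; apply; rewrite mulVKf// gt_eqF.
Qed.

Lemma is_derive_smooth_cut1 e s :
  is_derive s 1 (smooth_cut1 e) (smooth_cut2 e s).
Proof. exact: is_derive_affine (is_derive_ramp1 _). Qed.

Lemma smooth_cut2_continuous e : continuous (smooth_cut2 e).
Proof.
move=> s; apply: (continuous_atM (@cst_continuous R R e^-1 s)).
exact: (continuous_comp (@affine_continuous e^-1 (- 1) s)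
  (@ramp2_continuous _)).
Qed.

Lemma smooth_cut_bounds e s : 0 < e ->
  [/\ s <= e -> smooth_cut e s = 0, 0 <= smooth_cut e s,
      s - 2 * e <= smooth_cut e s & 0 <= s -> smooth_cut e s <= s].
Proof.
move=> e0; rewrite /smooth_cut; set z := _ + _.
have sE : s = e * (z + 1) by rewrite /z subrK mulVKf// gt_eqF.
have [r0 r1 r2 r3] := ramp_bounds z.
split.
- move=> se; rewrite r0 ?mulr0//; rewrite sE in se; nra.
- by rewrite mulr_ge0// ltW.
- by rewrite sE; nra.
- move=> s0; have [z0|z0] := leP z 0; first by rewrite r0// mulr0.
  by have := r3 (ltW z0); rewrite sE; nra.
Qed.

Lemma smooth_cut2_eq0 e s : 0 < e -> 3 * e <= s -> smooth_cut2 e s = 0.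
Proof.
move=> e0 se; rewrite /smooth_cut2 (ramp2_bounds _).2 ?mulr0//.
have : 3 <= e^-1 * s by rewrite mulrC ler_pdivlMr.
lra.
Qed.

Lemma smooth_cut2_ge0 e s : 0 < e -> 0 <= smooth_cut2 e s.
Proof.
move=> e0; rewrite mulr_ge0 ?invr_ge0 ?(ltW e0)//.
by have [] := ramp2_bounds (e^-1 * s + (- 1)).
Qed.

(* [s] above [- M], quadratic on [[- M - 1, - M]], and constant below. *)
Definition soft_floor M s : R :=
  s + (pospow 2 (- 1 * s + (- M)) - pospow 2 (- 1 * s + (- M - 1))) / 2.
Definition soft_floor1 M s : R :=
  1 - pospow 1 (- 1 * s + (- M)) + pospow 1 (- 1 * s + (- M - 1)).

Lemma is_derive_soft_floor M s :
  is_derive s 1 (soft_floor M) (soft_floor1 M s).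
Proof.
have := is_derive_add (is_derive_id s (1 : R)) (is_derive_mulr 2^-1 (is_derive_sub
  (is_derive_affine (is_derive_pospow 0 (- 1 * s + (- M))))
  (is_derive_affine (is_derive_pospow 0 (- 1 * s + (- M - 1)))))).
by move=> /is_derive_eq; apply; rewrite /soft_floor1; field.
Qed.

Lemma soft_floor1_continuous M : continuous (soft_floor1 M).
Proof.
move=> s; exact: (continuous_atD (continuous_atB (@cst_continuous R R 1 s)
  (@pospow_affine_continuous 1 (- 1) (- M) s))
  (@pospow_affine_continuous 1 (- 1) (- M - 1) s)).
Qed.

Lemma soft_floor1_ge0 M s : 0 <= soft_floor1 M s.
Proof.
rewrite /soft_floor1; set y := - 1 * s + - M.
rewrite (_ : -1 * s + (- M - 1) = y - 1); last by rewrite /y; ring.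
have [y0|y0] := leP y 0; first by rewrite !pospow_le0; try lra.
rewrite (pospow_ge0 _ (ltW y0)) expr1.
have [y1|y1] := leP y 1; first by rewrite !pospow_le0; try lra.
by rewrite pospow_ge0 ?expr1; lra.
Qed.

Lemma soft_floor_bounds M s : [/\ - M <= s -> soft_floor M s = s,
  s <= soft_floor M s, - M - 1 <= soft_floor M s &
  s <= - M -> soft_floor M s <= - M].
Proof.
rewrite /soft_floor; set y := - 1 * s + - M.
rewrite (_ : -1 * s + (- M - 1) = y - 1); last by rewrite /y; ring.
have sE : s = - y - M by rewrite /y; ring.
rewrite sE; clearbody y.
have [y0|y0] := leP y 0.
  by rewrite !pospow_le0; try lra; split=> *; lra.
rewrite (pospow_ge0 _ (ltW y0)).
have [y1|y1] := leP y 1; first by rewrite !pospow_le0; try lra; split=> *; nra.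
by rewrite pospow_ge0; try lra; split=> *; nra.
Qed.

End cutoffs.

(** * The tail integral H and its regularity *)

Section tail_integral.
Context {R : realType} (G : R -> R).
Hypotheses (G_gt0 : forall s, s < 1 -> 0 < G s)
  (G_noninc : forall s t, s <= t -> t < 1 -> G t <= G s)
  (G_cont : forall s, s < 1 -> {for s, continuous G}).
Local Notation mu := (@lebesgue_measure R).

(** Monotonicity bounds [G] by [G v] on the whole interval, including near 1. *)
Lemma tail_integrable v : mu.-integrable `]v, 1[ (EFin \o G).
Proof.
have [v1|v1] := ltP v 1; last first.
  by rewrite set_itv_ge ?integrable_set0// bnd_simp -leNgt.
apply: measurable_bounded_integrable => //.
- have /= -> := lebesgue_measure_itv (`]v, (1 : R)[).
  by rewrite lte_fin v1 -EFinB ltry.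
- apply: open_continuous_measurable_fun; first exact: interval_open.
  by move=> s; rewrite inE/= in_itv/= => /andP[_ s1]; exact: G_cont.
- exists (G v); split; first exact: num_real.
  move=> r Gr s; rewrite /= in_itv/= => /andP[vs s1].
  rewrite ger0_norm; last exact/ltW/G_gt0.
  by rewrite (le_trans _ (ltW Gr))// G_noninc// ltW.
Qed.

Lemma H_of_ge0 v : 0 <= H_of G v.
Proof.
apply: Rintegral_ge0 => s; rewrite /= in_itv/= => /andP[_ s1].
exact/ltW/G_gt0.
Qed.

Lemma is_derive_H_of (v : R) : v < 1 -> is_derive v 1 (H_of G) (- G v).
Proof.
(* The fundamental theorem differentiates in the upper end point, so near [v] the function is
   rewritten as [H_of G a] minus the integral from [a]; [b] leaves room between [v] and 1. *)
move=> v1; pose a := v - 1; pose b := (v + 1) / 2.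
have av : a < v by rewrite /a; lra.
have vb : v < b by rewrite /b; lra.
have b1 : b < 1 by rewrite /b; lra.
pose F y := \int[mu]_(s in `]a, y]) G s.
have iab : mu.-integrable `]a, b] (EFin \o G).
  apply: integrableS (tail_integrable a) => //.
  by move=> s; rewrite /= !in_itv/= => /andP[-> /le_lt_trans]; exact.
have [dF FE] := @continuous_FTC1 R G (BRight a) v b vb iab av (G_cont v1).
have HE : {near v, (fun y => H_of G a - F y) =1 H_of G}.
  near=> y; rewrite /H_of /F Rintegral_itvB//.
  - exact: tail_integrable.
  - by rewrite bnd_simp ltW//; near: y; exact: lt_nbhsr.
  - by rewrite bnd_simp; near: y; exact: lt_nbhsl.
have dF' : is_derive v 1 F (G v).
  by apply: DeriveDef => //; rewrite -derive1E.
apply: (near_eq_is_derive HE); rewrite -[- G v]add0r.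
exact: is_derive_sub (is_derive_cst (H_of G a) v _) dF'.
Unshelve. all: by end_near. Qed.

Lemma H_of_MVT x y : x < y -> y < 1 ->
  exists2 c, c < 1 & H_of G y - H_of G x = - G c * (y - x).
Proof.
move=> xy y1; have [||c] := @MVT R (H_of G) (fun s => - G s) x y xy.
- move=> s; rewrite in_itv/= => /andP[_ sy].
  by apply: is_derive_H_of; exact: lt_trans y1.
- apply: derivable_within_continuous => s; rewrite in_itv/= => /andP[_ sy].
  by have [] := is_derive_H_of (le_lt_trans sy y1).
by rewrite in_itv/= => /andP[_ cy] E; exists c => //; exact: lt_trans y1.
Qed.

(** The slope of [H_of G] is [- G], so [L] bounds it. This converts L^1 closeness to the initial
    value into a bound on the energy. *)
Lemma H_of_lipschitz L v w : (forall s, s < 1 -> G s <= L) -> v < 1 -> w < 1 ->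
  H_of G v <= H_of G w + L * `|v - w|.
Proof.
move=> GL v1 w1.
have [vw|wv|->] := ltgtP v w; last by rewrite subrr normr0 mulr0 addr0.
- have [c c1 E] := H_of_MVT vw w1; rewrite ltr0_norm ?subr_lt0//.
  by have := GL c c1; nra.
- have [c c1 E] := H_of_MVT wv v1; rewrite gtr0_norm ?subr_gt0//.
  by have := GL c c1; have := G_gt0 c1; nra.
Qed.

(** The value 0 on [[1, +oo[] keeps [H_of G] monotone on the whole line. Monotonicity gives
    measurability of [H_of g] composed with [u0], which is below 1 only almost everywhere. *)
Lemma H_of_nonincreasing v w : v <= w -> H_of G w <= H_of G v.
Proof.
have [w1|w1 _] := ltP w 1; last first.
  rewrite [X in X <= _]/H_of set_itv_ge ?Rintegral_set0 ?H_of_ge0//.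
  by rewrite bnd_simp -leNgt.
rewrite le_eqVlt => /predU1P[->//|vw].
have [c c1 E] := H_of_MVT vw w1.
by have := G_gt0 c1; nra.
Qed.

End tail_integral.

(** * Bounded domains *)

Section domain.
Context {R : realType} {n : nat} (Omega : set 'rV[R]_n).
Hypotheses (oO : open Omega) (bO : bounded_set Omega).

Lemma closure_boundary x : closure Omega x -> ~ Omega x -> boundary Omega x.
Proof. by move=> cx Ox; split=> //; rewrite (iffLR (interior_id _) oO). Qed.

Lemma compact_closure : compact (closure Omega).
Proof.
apply: bounded_closed_compact; last exact: closed_closure.
have /ex_strict_bound_gt0[M M0 HM] := bO.
exists M; split; first exact: num_real.
move=> r Mr x cx /=.
suff : closure Omega `<=` [set y : 'rV[R]_n | `|y| <= M].
  by move=> /(_ x cx) /= xM; rewrite (le_trans xM)// ltW.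
have cB : closed [set y : 'rV[R]_n | `|y| <= M].
  apply: (@closed_comp _ _ (fun x : 'rV[R]_n => `|x|) [set r | r <= M]).
    by move=> y _; exact: norm_continuous.
  exact: closed_le.
move=> y cy; apply: cB; apply: (@closureS _ Omega) => // z Oz /=.
exact/ltW/HM.
Qed.

Lemma Omega_lty : (lebesgue_rV R n Omega < +oo)%E.
Proof. by apply: bounded_lebesgue_rV => //; exact: open_measurable_rV. Qed.

Lemma within_closure_open (h : 'rV[R]_n -> R) :
  {within closure Omega, continuous h} ->
  forall x, Omega x -> {for x, continuous h}.
Proof.
move=> ch x Ox.
have : {within Omega, continuous h}.
  by apply: continuous_subspaceW ch; exact: subset_closure.
by rewrite continuous_open_subspace// => /(_ x); rewrite inE; exact.
Qed.

Lemma within_closure_bounded (h : 'rV[R]_n -> R) :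
  {within closure Omega, continuous h} ->
  exists2 K : R, 0 < K & forall x, closure Omega x -> `|h x| <= K.
Proof.
move=> ch; have /compact_bounded/ex_strict_bound_gt0[K K0 HK] :=
  continuous_compact ch compact_closure.
by exists K => // x cx; apply/ltW/HK; exists x.
Qed.

Lemma bounded_continuous_integrable (h : 'rV[R]_n -> R) K :
  (forall x, Omega x -> {for x, continuous h}) ->
  (forall x, Omega x -> `|h x| <= K) ->
  (lebesgue_rV R n).-integrable Omega (EFin \o h).
Proof.
move=> ch hK; apply: measurable_bounded_integrable.
- exact: open_measurable_rV.
- exact: Omega_lty.
- by apply: continuous_measurable_rV => // x /[!inE]; exact: ch.
- exists K; split; first exact: num_real.
  by move=> r Kr x Ox /=; rewrite (le_trans (hK x Ox))// ltW.
Qed.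

Lemma integral_gt0 (h : 'rV[R]_n -> R) x0 :
  (lebesgue_rV R n).-integrable Omega (EFin \o h) ->
  (forall x, Omega x -> 0 <= h x) ->
  Omega x0 -> {for x0, continuous h} -> 0 < h x0 ->
  0 < \int[lebesgue_rV R n]_(x in Omega) h x.
Proof.
move=> ih h0 Ox0 ch hx0.
have mO := open_measurable_rV oO.
have : \forall x \near x0, Omega x /\ h x0 / 2 < h x.
  near=> x; split; near: x; first exact: open_nbhs_nbhs.
  by apply: (cvgr_gt (h x0) ch); lra.
move=> /nbhs_ballP[r /= r0 Hr].
have mB := @measurable_ball_rV R n x0 r.
have BO : ball x0 r `<=` Omega by move=> x /Hr[].
have mh : measurable_fun Omega (EFin \o h) by exact: measurable_int ih.
apply: fine_gt0; apply/andP; split; last exact: integrable_lty.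
apply: (@lt_le_trans _ _
  (\int[lebesgue_rV R n]_(x in ball x0 r) (h x0 / 2)%:E)%E).
  rewrite integral_cst//; have /= -> := lebesgue_rV_ball x0 r0.
  by rewrite -EFinM lte_fin mulr_gt0 ?divr_gt0// exprn_gt0// mulr_gt0.
apply: (@le_trans _ _ (\int[lebesgue_rV R n]_(x in ball x0 r) (h x)%:E)%E).
  apply: ge0_le_integral => //.
  - by move=> x _; rewrite lee_fin divr_ge0// ltW.
  - exact: measurable_funS mO BO mh.
  - by move=> x /Hr[_ /ltW]; rewrite lee_fin.
by apply: ge0_subset_integral => // x /h0; rewrite lee_fin.
Unshelve. all: by end_near. Qed.

Lemma hoelder_on_continuous alpha (h : 'rV[R]_n -> R) (A : set 'rV[R]_n) :
  0 < alpha -> hoelder_on alpha A h -> {within A, continuous h}.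
Proof.
move=> a0 [C HC]; apply/subspace_continuousP => x Ax.
apply/cvgrPdist_lt => e e0.
(* [C] may be zero or negative, hence the positive constant [|C| + 1]; [d] solves
   [d ^ alpha = e / (|C| + 1)]. *)
have C1 : 0 < `|C| + 1 by rewrite ltr_wpDl.
pose q := e / (`|C| + 1); have q0 : 0 < q by rewrite divr_gt0.
pose d := q `^ alpha^-1; have d0 : 0 < d by rewrite powR_gt0.
have dE : d `^ alpha = q by rewrite -powRrM mulVf ?gt_eqF// powRr1 ?ltW.
have : \forall y \near x, `|x - y| < d.
  exact: (@cvgr_dist_lt _ _ _ (nbhs x) _ id x (@cvg_id _ _) d d0).
move=> near_d; rewrite near_withinE; apply: filterS near_d => y xyd Ay.
apply: le_lt_trans (HC x y Ax Ay) _.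
apply: (@le_lt_trans _ _ (`|C| * q)).
  have := ler_norm C; have := powR_ge0 `|x - y| alpha => p0 CC.
  apply: le_trans (ler_wpM2r p0 CC) _; rewrite ler_wpM2l// -dE.
  by apply: ge0_ler_powR; rewrite ?nnegrE//; apply: ltW.
by rewrite /q mulrCA gtr_pMr// ltr_pdivrMr// mul1r ltrDl.
Qed.

End domain.

(** * The energy and its time derivative *)

Lemma within_near_lt {R : realType} {S : topologicalType} (A : set S)
    (f : S -> R) x e : {within A, continuous f} -> A x -> f x < e ->
  \forall y \near x, A y -> f y < e.
Proof.
move=> /subspace_continuousP cf Ax fxe.
have cf' : f @ within A (nbhs x) --> f x := cf x Ax.
exact: (cvgr_lt (f x) cf' e fxe).
Qed.

Section product_continuity.
Context {S T U : topologicalType}.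

Lemma near_fst (P : set S) (x : S) (t : T) :
  (\forall y \near x, P y) -> \forall p \near (x, t), P p.1.
Proof.
move=> xP; exists (P, setT) => /=; last by case=> ? ? [].
by split=> //; exact: filterT.
Qed.

Lemma continuous_at_pairl (F : S * T -> U) (x : S) (t : T) :
  {for (x, t), continuous F} -> {for x, continuous (fun y => F (y, t))}.
Proof.
move=> cF; have cp : {for x, continuous (fun y : S => (y, t))}.
  by apply: cvg_pair; [exact: cvg_id|exact: cvg_cst].
exact: (continuous_comp cp cF).
Qed.

Lemma continuous_at_fst (f : S -> U) (x : S) (t : T) :
  {for x, continuous f} -> {for (x, t), continuous (fun p => f p.1)}.
Proof.
move=> cf; have cf1 : {for (x, t), continuous (@fst S T)} by exact: cvg_fst.
exact: (continuous_comp cf1 cf).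
Qed.

End product_continuity.

(** * The eigenfunction cut off near the boundary *)

Section cut_eigenfunction.
Context {R : realType} {n : nat} (Omega : set 'rV[R]_n).
Hypotheses (oO : open Omega) (bO : bounded_set Omega).
Variables (phi : 'rV[R]_n -> R) (mu : R).
Hypotheses (phi_C2 : pure_C2 Omega phi)
  (phi_cl : {within closure Omega, continuous phi})
  (phi_eq : forall x, Omega x -> laplacian phi x = - (mu * phi x))
  (phi_bd : forall x, boundary Omega x -> phi x = 0).

(** Extended by zero because [phi] is arbitrary outside the closure of [Omega]. *)
Definition cut_phi e := (smooth_cut e \o phi) \_ Omega.

Lemma cut_phiE e x : Omega x -> cut_phi e x = smooth_cut e (phi x).
Proof. by move=> Ox; rewrite /cut_phi patchE mem_set. Qed.

(** At a boundary point [phi] is 0, so by continuity it stays below [e] nearby, where [smooth_cut e]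
    is zero; away from the closure the extension is zero by construction. *)
Lemma cut_phi_vanishes e : 0 < e -> vanishes_off Omega (cut_phi e).
Proof.
move=> e0 x Ox; have [cx|cx] := pselect (closure Omega x).
  have phix : phi x < e by rewrite (phi_bd (closure_boundary oO cx Ox)).
  apply: filterS (within_near_lt phi_cl cx phix) => y ye.
  rewrite /cut_phi patchE; case: ifPn => //=; rewrite inE => Oy.
  have [-> //] := smooth_cut_bounds (phi y) e0.
  exact/ltW/ye/subset_closure.
have : \forall y \near x, ~ closure Omega y.
  apply: (open_nbhs_nbhs (A := ~` closure Omega)); split => //.
  by rewrite openC; exact: closed_closure.
move=> H; apply: filterS H => y cy; rewrite /cut_phi patchE; case: ifPn => //=.
by rewrite inE => /subset_closure/cy.
Qed.

Lemma cut_phi_C2 e : 0 < e -> pure_C2 Omega (cut_phi e) /\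
  forall x, Omega x -> laplacian (cut_phi e) x =
    smooth_cut2 e (phi x) * (\sum_(i < n) 'D_(base_rV R i) phi x ^+ 2) -
    smooth_cut1 e (phi x) * (mu * phi x).
Proof.
move=> e0; have [c2 lE] := pure_C2_comp oO (S := setT) phi_C2 (fun _ _ => I)
  (fun x Ox => cut_phiE e Ox) (fun s _ => is_derive_smooth_cut s e0)
  (fun s _ => is_derive_smooth_cut1 e s)
  (fun s _ => @smooth_cut2_continuous _ e s).
by split=> // x Ox; rewrite lE// phi_eq// mulrN.
Qed.

End cut_eigenfunction.

(** * Differentiation of the energy in time *)

Section energy.
Context {R : realType} {n : nat} (Omega : set 'rV[R]_n).
Hypotheses (oO : open Omega) (bO : bounded_set Omega).
Variables (T : \bar R) (u : 'rV[R]_n -> R -> R).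
Hypotheses (u_C2 : forall t, times T t -> pure_C2 Omega (u ^~ t))
  (u_cont : forall x t, Omega x -> times T t ->
     {for (x, t), continuous (fun p => u p.1 p.2)})
  (u_der : forall x t, Omega x -> times T t -> derivable (u x) t 1)
  (u_dcont : forall x t, Omega x -> times T t ->
     {for (x, t), continuous (fun p => (u p.1)^`()%classic p.2)})
  (u_lt1 : forall x t, Omega x -> times T t -> u x t < 1).
Variables (G G1 : R -> R).
Hypotheses (G_gt0 : forall s, s < 1 -> 0 < G s)
  (G_noninc : forall s t, s <= t -> t < 1 -> G t <= G s)
  (G_der : forall s : R, s < 1 -> is_derive s 1 G (G1 s))
  (G1_cont : forall s : R, s < 1 -> {for s, continuous G1})
  (G1_le0 : forall s, s < 1 -> G1 s <= 0).

Let G_cont (s : R) : s < 1 -> {for s, continuous G}.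
Proof.
by move=> /G_der[d _]; apply: differentiable_continuous; exact/derivable1_diffP.
Qed.

Lemma times_sub a b t : times T a -> times T b -> a <= t <= b -> times T t.
Proof.
move=> /andP[a0 _] /andP[_ bT] /andP[at_ tb]; apply/andP; split.
  by rewrite (lt_le_trans a0).
by rewrite (le_lt_trans _ bT).
Qed.

Lemma times_between t : times T t ->
  exists a b, [/\ a < t, t < b, times T a & times T b].
Proof.
move=> /andP[]; rewrite lte_fin => t0 tT.
have [b tb bT] : exists2 b, t < b & (b%:E < T)%E.
  case: (T) tT => [r| |//]; last by exists (t + 1); rewrite ?ltrDl ?ltry.
  by rewrite lte_fin => tr; exists ((t + r) / 2); rewrite ?lte_fin; lra.
exists (t / 2), b; split=> //; first by lra.
  apply/andP; rewrite !lte_fin; split; first lra.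
  by rewrite (lt_trans _ tT)// lte_fin; lra.
by apply/andP; rewrite !lte_fin; split=> //; lra.
Qed.

(** Time derivatives of [u] are controlled only inside [Omega]. A factor with support in [Omega]
    makes [F] vanish near the lateral boundary, uniformly in time, hence continuous on a compact
    cylinder. *)
Lemma spacetime_bounded (F : 'rV[R]_n * R -> R) a b :
  times T a -> times T b ->
  (forall x t, Omega x -> times T t -> {for (x, t), continuous F}) ->
  (forall x, ~ Omega x -> \forall y \near x, forall t, F (y, t) = 0) ->
  exists2 K : R, 0 < K & forall x t, Omega x -> a <= t <= b -> `|F (x, t)| <= K.
Proof.
move=> Ta Tb cF vF.
have cK : compact (closure Omega `*` `[a, b]).
  by apply: compact_setX; [exact: compact_closure|exact: segment_compact].
have cFK : {within closure Omega `*` `[a, b], continuous F}.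
  apply: continuous_in_subspaceT => -[x t]; rewrite inE/= => -[_].
  rewrite /= in_itv/= => tab.
  have [Ox|Ox] := pselect (Omega x); first by apply: cF => //; exact: times_sub tab.
  apply: (near_eq_continuous_at (f := cst 0)); last exact: cst_continuous.
  by apply: filterS (near_fst t (vF x Ox)) => -[y r] /= ->.
have /compact_bounded/ex_strict_bound_gt0[K K0 HK] := continuous_compact cFK cK.
exists K => // x t Ox tab; apply/ltW/HK; exists (x, t) => //; split => /=.
  exact: subset_closure.
by rewrite in_itv.
Qed.

Definition energy (w : 'rV[R]_n -> R) (t : R) : R :=
  \int[lebesgue_rV R n]_(x in Omega) (H_of G (u x t) * w x).

Let Hu_cont x t : Omega x -> times T t ->
  {for x, continuous (fun y => H_of G (u y t))}.
Proof.
move=> Ox Tt.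
have cu := continuous_at_pairl (u_cont Ox Tt).
have [d _] := is_derive_H_of G_gt0 G_noninc G_cont (u_lt1 Ox Tt).
apply: (@continuous_comp _ _ _ (fun y => u y t) (H_of G)) => //.
by apply: differentiable_continuous; exact/derivable1_diffP.
Qed.

Let is_derive_Hu x t : Omega x -> times T t ->
  is_derive t 1 (fun r => H_of G (u x r)) (- G (u x t) * (u x)^`()%classic t).
Proof.
move=> Ox Tt; rewrite derive1E.
have := is_derive_H_of G_gt0 G_noninc G_cont (u_lt1 Ox Tt).
exact: (is_derive_comp_dir (u_der Ox Tt)).
Qed.

Lemma energy_integrand_integrable w t : pure_C2 Omega w ->
  vanishes_off Omega w -> times T t ->
  (lebesgue_rV R n).-integrable Omega (EFin \o (fun x => H_of G (u x t) * w x)).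
Proof.
move=> cw vw Tt; apply: vanishes_off_integrable => // [x Ox|].
  by have [cwx _] := cw x Ox; exact: continuous_atM (Hu_cont Ox Tt) cwx.
exact: vanishes_offMr.
Qed.

(** Differentiation under the integral on a time interval around [t] compactly inside [times T]; the
    dominating function is the constant from [spacetime_bounded], integrable because [Omega] has
    finite measure. *)
Lemma is_derive_energy w t : pure_C2 Omega w -> vanishes_off Omega w ->
  times T t ->
  is_derive t 1 (energy w) (\int[lebesgue_rV R n]_(x in Omega)
    (- G (u x t) * (u x)^`()%classic t * w x)).
Proof.
move=> cw vw Tt; have [a [b [at_ tb Ta Tb]]] := times_between Tt.
pose F p := - G (u p.1 p.2) * (u p.1)^`()%classic p.2 * w p.1.
have [|x Ox|K K0 HK] := @spacetime_bounded F a b Ta Tb.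
- move=> x r Ox Tr; have [cwx _] := cw x Ox.
  have cGu : {for (x, r), continuous (fun p => - G (u p.1 p.2))}.
    apply: (@continuous_comp _ _ _ (fun p => u p.1 p.2) (fun s => - G s)).
      exact: u_cont.
    by apply: cvgN; exact: G_cont (u_lt1 Ox Tr).
  have cdu : {for (x, r), continuous
      (fun p : 'rV[R]_n * R => (u p.1)^`()%classic p.2)} by exact: u_dcont.
  have cw1 : {for (x, r), continuous (fun p : 'rV[R]_n * R => w p.1)}.
    exact: continuous_at_fst.
  exact: (continuous_atM (continuous_atM cGu cdu) cw1).
- by apply: filterS (vw x Ox) => y wy r; rewrite /F /= wy mulr0.
have mO := open_measurable_rV oO.
pose I : set R := `]a, b[%classic.
have It : I t by rewrite /I /= in_itv/= at_.
have IT r : I r -> times T r /\ a <= r <= b.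
  rewrite /I /= in_itv/= => /andP[/ltW ar /ltW rb].
  by split; [apply: (times_sub Ta Tb)|]; rewrite ar rb.
have iH r : I r -> (lebesgue_rV R n).-integrable Omega
    (EFin \o (fun x => H_of G (u x r) * w x)).
  by move=> /IT[Tr _]; exact: energy_integrand_integrable.
have dH r x : I r -> Omega x ->
    is_derive r 1 (fun r => H_of G (u x r) * w x) (F (x, r)).
  by move=> /IT[Tr _] Ox; exact: is_derive_mulr (is_derive_Hu Ox Tr).
have iK : (lebesgue_rV R n).-integrable Omega (EFin \o cst K).
  apply: (bounded_continuous_integrable oO bO (K := K)) => x Ox.
    exact: cst_continuous.
  by rewrite /= gtr0_norm.
have dHE r x : I r -> Omega x ->
    partial1of2 (fun r x => H_of G (u x r) * w x) r x = F (x, r).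
  by move=> Ir Ox; have [_ <-] := dH r x Ir Ox; rewrite partial1of2E.
have dH' r x : I r -> Omega x ->
    derivable (fun r => H_of G (u x r) * w x) r 1.
  by move=> Ir Ox; have [] := dH r x Ir Ox.
have HK' r x : I r -> Omega x ->
    `|partial1of2 (fun r x => H_of G (u x r) * w x) r x| <= cst K x.
  by move=> Ir Ox; rewrite dHE//; apply: HK => //; have [] := IT r Ir.
apply: DeriveDef.
  exact: (@derivable_under_integral _ _ _ (lebesgue_rV R n)
    (fun r x => H_of G (u x r) * w x) Omega mO t a b It iH dH' (cst K)
    (fun _ => ltW K0) iK HK').
rewrite -derive1E.
rewrite (@differentiation_under_integral _ _ _ (lebesgue_rV R n)
    (fun r x => H_of G (u x r) * w x) Omega mO t a b It iH dH' (cst K)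
    (fun _ => ltW K0) iK HK').
by apply: eq_Rintegral => x /[!inE] Ox; rewrite dHE.
Qed.

End energy.

(** * Decay of the energy *)

Section energy_decay.
Context {R : realType} {n : nat} (Omega : set 'rV[R]_n).
Hypotheses (oO : open Omega) (bO : bounded_set Omega).
Variables (T : \bar R) (u : 'rV[R]_n -> R -> R).
Hypotheses (u_C2 : forall t, times T t -> pure_C2 Omega (u ^~ t))
  (u_cont : forall x t, Omega x -> times T t ->
     {for (x, t), continuous (fun p => u p.1 p.2)})
  (u_der : forall x t, Omega x -> times T t -> derivable (u x) t 1)
  (u_dcont : forall x t, Omega x -> times T t ->
     {for (x, t), continuous (fun p => (u p.1)^`()%classic p.2)})
  (u_lt1 : forall x t, Omega x -> times T t -> u x t < 1).
Variables (G G1 : R -> R).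
Hypotheses (G_gt0 : forall s, s < 1 -> 0 < G s)
  (G_noninc : forall s t, s <= t -> t < 1 -> G t <= G s)
  (G_der : forall s : R, s < 1 -> is_derive s 1 G (G1 s))
  (G1_cont : forall s : R, s < 1 -> {for s, continuous G1})
  (G1_le0 : forall s, s < 1 -> G1 s <= 0).
Variables (phi : 'rV[R]_n -> R) (mu : R).
Hypotheses (phi_C2 : pure_C2 Omega phi)
  (phi_cl : {within closure Omega, continuous phi})
  (phi_eq : forall x, Omega x -> laplacian phi x = - (mu * phi x))
  (phi_bd : forall x, boundary Omega x -> phi x = 0)
  (phi_gt0 : forall x, Omega x -> 0 < phi x)
  (phi_int : \int[lebesgue_rV R n]_(x in Omega) phi x = 1)
  (mu_ge0 : 0 <= mu).
Variables (f : 'rV[R]_n -> R) (g : R -> R) (lambda Fm : R).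
Hypotheses (f_cl : {within closure Omega, continuous f})
  (f_ge0 : forall x, Omega x -> 0 <= f x)
  (f_le : forall x, Omega x -> f x <= Fm)
  (g_gt0 : forall s, s < 1 -> 0 < g s)
  (lambda_ge0 : 0 <= lambda)
  (u_eq : forall x t, Omega x -> times T t ->
     (u x)^`()%classic t = laplacian (u ^~ t) x + lambda * f x / g (u x t)).

Let G_cont (s : R) : s < 1 -> {for s, continuous G}.
Proof.
by move=> /G_der[d _]; apply: differentiable_continuous; exact/derivable1_diffP.
Qed.

Let K kappa t x := H_of G (u x t) - kappa.

Lemma K_C2 kappa t : times T t -> pure_C2 Omega (K kappa t) /\
  forall x, Omega x -> laplacian (K kappa t) x =
    - G1 (u x t) * (\sum_(i < n) 'D_(base_rV R i) (u ^~ t) x ^+ 2) +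
    - G (u x t) * laplacian (u ^~ t) x.
Proof.
move=> Tt; apply: (pure_C2_comp oO (v := u ^~ t) (S := [set s | s < 1])
    (th := fun s => H_of G s - kappa) (th1 := fun s => - G s)
    (th2 := fun s => - G1 s)).
- exact: u_C2.
- by move=> x Ox; exact: u_lt1.
- by [].
- move=> s s1; rewrite -[- G s]subr0.
  exact: is_derive_sub (is_derive_H_of G_gt0 G_noninc G_cont s1)
    (is_derive_cst kappa s _).
- move=> s s1; have dG := G_der s1; exact: is_deriveN.
- by move=> s s1; apply: cvgN; exact: G1_cont.
Qed.

Lemma phi_integrable : (lebesgue_rV R n).-integrable Omega (EFin \o phi).
Proof.
have [Kp _ HK] := within_closure_bounded bO phi_cl.
apply: (bounded_continuous_integrable oO bO (K := Kp)).
  exact: within_closure_open.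
by move=> x Ox; apply: HK; exact: subset_closure.
Qed.

Lemma fphi_integrable :
  (lebesgue_rV R n).-integrable Omega (EFin \o (fun x => f x * phi x)).
Proof.
have [Kp _ HK] := within_closure_bounded bO phi_cl.
apply: (bounded_continuous_integrable oO bO (K := Fm * Kp)) => x Ox.
  exact: (continuous_atM (within_closure_open oO f_cl Ox)
    (within_closure_open oO phi_cl Ox)).
rewrite normrM ler_pM// ?ger0_norm ?f_ge0 ?f_le//; last exact/ltW/phi_gt0.
have := HK x (subset_closure Ox); rewrite ger0_norm//; exact/ltW/phi_gt0.
Qed.

(* Integrating this inequality kills the Green term.  After Green's formula the
   only term without a sign is [K * smooth_cut2 e phi * |grad phi|^2], and where
   [smooth_cut2 e phi] is nonzero one has [phi <= 3 * e], hence [K <= 0]. *)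
Lemma energy_rate_pointwise e kappa c t x : 0 < e -> 0 <= kappa -> 0 <= c ->
  times T t -> Omega x ->
  c * g (u x t) <= G (u x t) ->
  (phi x <= 3 * e -> H_of G (u x t) <= kappa) ->
  - G (u x t) * (u x)^`()%classic t * cut_phi Omega phi e x <=
    (laplacian (K kappa t) x * cut_phi Omega phi e x -
       K kappa t x * laplacian (cut_phi Omega phi e) x) +
    ((kappa * mu * phi x - lambda * c * (f x * phi x)) +
     2 * lambda * c * e * Fm).
Proof.
move=> e0 k0 c0 Tt Ox cg near_bd.
have [_ LK] := K_C2 kappa Tt.
have [_ Lw] := cut_phi_C2 oO phi_C2 phi_eq e0.
rewrite LK// Lw// u_eq// cut_phiE// /K.
have u1 := u_lt1 Ox Tt.
have [_ w0 w1 /(_ (ltW (phi_gt0 Ox))) w2] := smooth_cut_bounds (phi x) e0.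
have p0 := phi_gt0 Ox; have f0 := f_ge0 Ox; have fm := f_le Ox.
have H0 := H_of_ge0 G_gt0 (u x t).
have [s1 s2] : 0 <= smooth_cut1 e (phi x) /\ smooth_cut1 e (phi x) <= 1.
  by apply/andP; exact: ramp1_bounds.
have t0 := smooth_cut2_ge0 (phi x) e0.
have tK : smooth_cut2 e (phi x) * (H_of G (u x t) - kappa) <= 0.
  have [p3|p3] := leP (phi x) (3 * e).
    by rewrite mulr_ge0_le0// subr_le0 near_bd.
  by rewrite smooth_cut2_eq0// ?mul0r// ltW.
have G10 := G1_le0 u1; have g0 := g_gt0 u1; have G0 := G_gt0 u1.
have S0 : 0 <= \sum_(i < n) 'D_(base_rV R i) (u^~ t) x ^+ 2.
  by apply: sumr_ge0 => i _; exact: sqr_ge0.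
have P0 : 0 <= \sum_(i < n) 'D_(base_rV R i) phi x ^+ 2.
  by apply: sumr_ge0 => i _; exact: sqr_ge0.
have cG : c <= G (u x t) / g (u x t) by rewrite ler_pdivlMr.
move: (smooth_cut e (phi x)) w0 w1 w2 => w w0 w1 w2.
move: (smooth_cut1 e (phi x)) s1 s2 => s s0 s1.
move: (smooth_cut2 e (phi x)) t0 tK => r r0 rK.
move: (H_of G (u x t)) H0 rK {near_bd} => h h0 rK.
move: (laplacian (u^~ t) x) => L.
move: (\sum_(i < n) _) S0 => S S0.
move: (\sum_(i < n) _) P0 => P P0.
rewrite (_ : - G (u x t) * (L + lambda * f x / g (u x t)) * w =
  - G (u x t) * L * w - lambda * (f x) * w * (G (u x t) / g (u x t))); last first.
  by field; rewrite gt_eqF.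
move: (G (u x t) / g (u x t)) cG => q cq.
move: (G (u x t)) (G1 (u x t)) G10 {cg G0} => Gu Gu1 G10.
move: (f x) (phi x) p0 f0 fm w1 w2 => fx p p0 f0 fm w1 w2 {LK Lw u1 g0}.
(* The right side minus the left side is the sum of six nonnegative terms: monotonicity of [G]
   ([A1]), the boundary layer ([A2]), the eigenvalue term, where [h] and [1 - s] are nonnegative
   ([A3]), the source with [c <= G / g] ([A4]), the loss [w >= p - 2 * e] ([A5]), and [fx <= Fm]
   inside that loss ([A6]). *)
have A1 : 0 <= - Gu1 * S * w by rewrite !mulr_ge0// oppr_ge0.
have A2 : 0 <= - (r * (h - kappa) * P) by rewrite oppr_ge0 mulr_le0_ge0.
have A3 : (h - kappa) * (s * (mu * p)) + kappa * mu * p >= 0.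
  rewrite (_ : _ + _ = (h * s + kappa * (1 - s)) * (mu * p)); last by ring.
  rewrite mulr_ge0//; last by rewrite mulr_ge0// ltW.
  by rewrite addr_ge0// mulr_ge0// subr_ge0.
have lf0 : 0 <= lambda * fx by rewrite mulr_ge0.
have A4 : 0 <= lambda * fx * w * (q - c).
  by rewrite !mulr_ge0// subr_ge0.
have A5 : 0 <= lambda * c * (fx * (w - p + 2 * e)).
  by rewrite !mulr_ge0//; lra.
have A6 : 0 <= 2 * lambda * c * e * (Fm - fx).
  by rewrite !mulr_ge0// ?subr_ge0// ltW.
rewrite -subr_ge0.
rewrite (_ : _ - _ = - Gu1 * S * w + - (r * (h - kappa) * P) +
  ((h - kappa) * (s * (mu * p)) + kappa * mu * p) +
  lambda * fx * w * (q - c) + lambda * c * (fx * (w - p + 2 * e)) +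
  2 * lambda * c * e * (Fm - fx)); last by ring.
exact: addr_ge0 (addr_ge0 (addr_ge0 (addr_ge0 (addr_ge0 A1 A2) A3) A4) A5) A6.
Qed.

Let V := fine (lebesgue_rV R n Omega).

Lemma energy_rate e kappa c t : 0 < e -> 0 <= kappa -> 0 <= c ->
  times T t ->
  (forall x, Omega x -> c * g (u x t) <= G (u x t)) ->
  (forall x, Omega x -> phi x <= 3 * e -> H_of G (u x t) <= kappa) ->
  \int[lebesgue_rV R n]_(x in Omega)
    (- G (u x t) * (u x)^`()%classic t * cut_phi Omega phi e x) <=
  kappa * mu - lambda * c * integral_f_phi Omega f phi +
    2 * lambda * c * e * Fm * V.
Proof.
move=> e0 k0 c0 Tt cg near_bd.
have mO := open_measurable_rV oO.
have [cK _] := K_C2 kappa Tt.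
have [cw _] := cut_phi_C2 oO phi_C2 phi_eq e0.
have vw := cut_phi_vanishes oO phi_cl phi_bd e0.
pose gr x := laplacian (K kappa t) x * cut_phi Omega phi e x -
       K kappa t x * laplacian (cut_phi Omega phi e) x.
have igr : (lebesgue_rV R n).-integrable Omega (EFin \o gr).
  apply: vanishes_off_integrable => //.
    exact: green_integrand_continuous.
  by apply: vanishes_offD; [exact: vanishes_offMr|
    apply/vanishes_offN/vanishes_offMr/vanishes_off_laplacian].
have ip : (lebesgue_rV R n).-integrable Omega
    (EFin \o (fun x => kappa * mu * phi x)).
  have := integrableZl mO (kappa * mu) phi_integrable.
  by apply: eq_integrable => // x _.
have ifp : (lebesgue_rV R n).-integrable Omega
    (EFin \o (fun x => lambda * c * (f x * phi x))).
  have := integrableZl mO (lambda * c) fphi_integrable.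
  by apply: eq_integrable => // x _.
have ic : (lebesgue_rV R n).-integrable Omega
    (EFin \o cst (2 * lambda * c * e * Fm)).
  apply: (bounded_continuous_integrable oO bO
    (K := `|2 * lambda * c * e * Fm|)) => x Ox //.
  exact: cst_continuous.
have ipf : (lebesgue_rV R n).-integrable Omega
    (EFin \o (fun x => kappa * mu * phi x - lambda * c * (f x * phi x))).
  have := integrableB mO ip ifp.
  by apply: eq_integrable => // x _.
have ipfc : (lebesgue_rV R n).-integrable Omega
    (EFin \o (fun x => (kappa * mu * phi x - lambda * c * (f x * phi x)) +
      2 * lambda * c * e * Fm)).
  have := integrableD mO ipf ic.
  by apply: eq_integrable => // x _.
have iall : (lebesgue_rV R n).-integrable Omega
    (EFin \o (fun x => gr x + ((kappa * mu * phi x - lambda * c * (f x * phi x)) +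
      2 * lambda * c * e * Fm))).
  have := integrableD mO igr ipfc.
  by apply: eq_integrable => // x _.
have il : (lebesgue_rV R n).-integrable Omega (EFin \o (fun x =>
    - G (u x t) * (u x)^`()%classic t * cut_phi Omega phi e x)).
  apply: vanishes_off_integrable => //; last exact: vanishes_offMr.
  move=> x Ox; have [cwx _] := cw x Ox.
  have cu := continuous_at_pairl (u_cont Ox Tt).
  have cdu := continuous_at_pairl (u_dcont Ox Tt).
  have cGu : {for x, continuous (fun y => - G (u y t))}.
    apply: (@continuous_comp _ _ _ (fun y => u y t) (fun s => - G s)) => //.
    by apply: cvgN; exact: G_cont (u_lt1 Ox Tt).
  exact: (continuous_atM (continuous_atM cGu cdu) cwx).
apply: (le_trans (le_Rintegral mO il iall _)).
  by move=> x Ox; exact: energy_rate_pointwise (cg x Ox) (near_bd x Ox).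
have E1 : \int[lebesgue_rV R n]_(x in Omega) (kappa * mu * phi x) = kappa * mu.
  by rewrite (RintegralZl _ mO phi_integrable) phi_int mulr1.
have E2 : \int[lebesgue_rV R n]_(x in Omega) (lambda * c * (f x * phi x)) =
    lambda * c * integral_f_phi Omega f phi.
  by rewrite (RintegralZl _ mO fphi_integrable).
rewrite (RintegralD mO igr ipfc) (green_identity oO bO cK cw vw) add0r.
by rewrite (RintegralD mO ipf ic) (RintegralB mO ip ifp) E1 E2 Rintegral_cst.
Qed.

(** The number [c] is the fraction of the source that survives the replacement of [g] by [G]; it
    will be 1 where both agree along [u] and 0 where only the sign of [G] is known. *)
Lemma energy_decay e kappa c t1 t2 : 0 < e -> 0 <= kappa -> 0 <= c ->
  times T t1 -> times T t2 -> t1 <= t2 ->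
  (forall x t, Omega x -> t1 <= t <= t2 -> c * g (u x t) <= G (u x t)) ->
  (forall x t, Omega x -> t1 <= t <= t2 -> phi x <= 3 * e ->
     H_of G (u x t) <= kappa) ->
  energy Omega u G (cut_phi Omega phi e) t2 <=
  energy Omega u G (cut_phi Omega phi e) t1 +
  (kappa * mu - lambda * c * integral_f_phi Omega f phi +
    2 * lambda * c * e * Fm * V) * (t2 - t1).
Proof.
move=> e0 k0 c0 Tt1 Tt2 t12 cg near_bd.
have [cw _] := cut_phi_C2 oO phi_C2 phi_eq e0.
have vw := cut_phi_vanishes oO phi_cl phi_bd e0.
have dE t : t1 <= t <= t2 -> is_derive t 1
    (energy Omega u G (cut_phi Omega phi e)) (\int[lebesgue_rV R n]_(x in Omega)
    (- G (u x t) * (u x)^`()%classic t * cut_phi Omega phi e x)).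
  move=> t12'; have Tt := times_sub Tt1 Tt2 t12'.
  exact: (is_derive_energy oO bO u_cont u_der u_dcont u_lt1 G_gt0 G_noninc G_der).
rewrite -lerBlDl.
have [||t tI ->] := MVT_segment t12
  (f := energy Omega u G (cut_phi Omega phi e))
  (df := fun t => \int[lebesgue_rV R n]_(x in Omega)
    (- G (u x t) * (u x)^`()%classic t * cut_phi Omega phi e x)).
- move=> t; rewrite in_itv/= => /andP[/ltW a1 /ltW a2].
  by apply: dE; rewrite a1.
- apply: derivable_within_continuous => t; rewrite in_itv/= => tI.
  by have [] := dE t tI.
rewrite in_itv/= in tI; rewrite ler_wpM2r ?subr_ge0//.
apply: energy_rate => //.
- exact: times_sub tI.
- by move=> x Ox; exact: cg.
- by move=> x Ox; exact: near_bd.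
Qed.

End energy_decay.

(** * Flattening g near -oo, and estimates near the boundary *)

Section flattening.
Context {R : realType} (g : R -> R).
Hypotheses (g_gt0 : forall s, s < 1 -> 0 < g s) (g_C2 : C2_lt1 g)
  (g'_le0 : forall s, s < 1 -> g^`()%classic s <= 0).

Lemma C2_lt1_is_derive (s : R) : s < 1 -> is_derive s 1 g (g^`()%classic s).
Proof. by move=> /g_C2[d _ _]; apply: DeriveDef => //; rewrite derive1E. Qed.

Lemma C2_lt1_derive_continuous (s : R) : s < 1 ->
  {for s, continuous g^`()%classic}.
Proof.
by move=> /g_C2[_ d _]; apply: differentiable_continuous; exact/derivable1_diffP.
Qed.

Lemma C2_lt1_continuous (s : R) : s < 1 -> {for s, continuous g}.
Proof.
by move=> /g_C2[d _ _]; apply: differentiable_continuous; exact/derivable1_diffP.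
Qed.

Lemma C2_lt1_nonincreasing s t : s <= t -> t < 1 -> g t <= g s.
Proof.
move=> st t1; apply: (@ler0_derive1_nincr _ g s t) => //.
- by move=> x; rewrite in_itv/= => /andP[_ xt]; have [] := g_C2 (lt_trans xt t1).
- by move=> x; rewrite in_itv/= => /andP[_ xt]; exact: g'_le0 (lt_trans xt t1).
- apply: derivable_within_continuous => x; rewrite in_itv/= => /andP[_ xt].
  by have [] := g_C2 (le_lt_trans xt t1).
Qed.

Variable M : R.
Hypothesis M_ge0 : 0 <= M.

Definition flatten_below : R -> R := g \o soft_floor M.
Definition flatten_below1 s : R := g^`()%classic (soft_floor M s) * soft_floor1 M s.

Lemma soft_floor_lt1 s : s < 1 -> soft_floor M s < 1.
Proof.
move=> s1; have [h1 _ _ h2] := soft_floor_bounds M s.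
have [sM|Ms] := leP s (- M); last by rewrite h1// ltW.
by rewrite (le_lt_trans (h2 sM))// (le_lt_trans _ ltr01)// oppr_le0.
Qed.

Lemma flatten_below_gt0 s : s < 1 -> 0 < flatten_below s.
Proof. by move=> s1; apply: g_gt0; exact: soft_floor_lt1. Qed.

Lemma is_derive_flatten_below (s : R) : s < 1 ->
  is_derive s 1 flatten_below (flatten_below1 s).
Proof.
move=> s1; apply: is_derive1_comp (is_derive_soft_floor M s).
exact: C2_lt1_is_derive (soft_floor_lt1 s1).
Qed.

Lemma flatten_below1_continuous (s : R) : s < 1 ->
  {for s, continuous flatten_below1}.
Proof.
move=> s1; have [d _] := is_derive_soft_floor M s.
have csf : {for s, continuous (soft_floor M)}.
  by apply: differentiable_continuous; exact/derivable1_diffP.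
have c1 : {for s, continuous (fun s => g^`()%classic (soft_floor M s))}.
  exact: (continuous_comp csf (C2_lt1_derive_continuous (soft_floor_lt1 s1))).
exact: (continuous_atM c1 (@soft_floor1_continuous _ M s)).
Qed.

Lemma flatten_below1_le0 s : s < 1 -> flatten_below1 s <= 0.
Proof.
move=> s1; rewrite mulr_le0_ge0 ?soft_floor1_ge0// g'_le0//.
exact: soft_floor_lt1.
Qed.

Lemma flatten_below_continuous (s : R) : s < 1 -> {for s, continuous flatten_below}.
Proof.
move=> /is_derive_flatten_below[d _].
by apply: differentiable_continuous; exact/derivable1_diffP.
Qed.

Lemma flatten_below_nonincreasing s t : s <= t -> t < 1 ->
  flatten_below t <= flatten_below s.
Proof.
move=> st t1; apply: (@ler0_derive1_nincr _ flatten_below s t) => //.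
- move=> x; rewrite in_itv/= => /andP[_ xt].
  by have [] := is_derive_flatten_below (lt_trans xt t1).
- move=> x; rewrite in_itv/= => /andP[_ xt]; rewrite derive1E.
  have [_ ->] := is_derive_flatten_below (lt_trans xt t1).
  exact: flatten_below1_le0 (lt_trans xt t1).
- apply: derivable_within_continuous => x; rewrite in_itv/= => /andP[_ xt].
  by have [] := is_derive_flatten_below (le_lt_trans xt t1).
Qed.

Lemma flatten_below_le s : s < 1 -> flatten_below s <= g s.
Proof.
move=> s1; apply: C2_lt1_nonincreasing; last exact: soft_floor_lt1.
by have [] := soft_floor_bounds M s.
Qed.

(** This global bound is the Lipschitz constant of the modified H; [- M - 1] is a lower bound of
    [soft_floor M]. *)
Lemma flatten_below_bounded s : s < 1 -> flatten_below s <= g (- M - 1).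
Proof.
move=> s1; apply: C2_lt1_nonincreasing; last exact: soft_floor_lt1.
by have [] := soft_floor_bounds M s.
Qed.

Lemma flatten_belowE s : - M <= s -> flatten_below s = g s.
Proof. by move=> Ms; rewrite /flatten_below /=; have [->] := soft_floor_bounds M s. Qed.

Lemma H_of_flatten_below_le v : H_of flatten_below v <= H_of g v.
Proof.
apply: le_Rintegral => //.
- exact: (tail_integrable flatten_below_gt0 flatten_below_nonincreasing
    flatten_below_continuous).
- exact: (tail_integrable g_gt0 C2_lt1_nonincreasing C2_lt1_continuous).
- by move=> s; rewrite /= in_itv/= => /andP[_]; exact: flatten_below_le.
Qed.

(** The change takes place below [- M <= 0], so the threshold H(0), and with it [lambda'], is
    preserved. *)
Lemma H_of_flatten_below0 : H_of flatten_below 0 = H_of g 0.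
Proof.
apply: eq_Rintegral => s; rewrite inE/= in_itv/= => /andP[s0 _].
by rewrite flatten_belowE// (le_trans _ (ltW s0))// oppr_le0.
Qed.

End flattening.

(** * Bounds on compact time intervals and the boundary layer *)

Section near_boundary.
Context {R : realType} {n : nat} (Omega : set 'rV[R]_n).
Hypotheses (oO : open Omega) (bO : bounded_set Omega).
Variables (T : \bar R) (u : 'rV[R]_n -> R -> R) (phi : 'rV[R]_n -> R).
Hypotheses (phi_cl : {within closure Omega, continuous phi})
  (phi_gt0 : forall x, Omega x -> 0 < phi x)
  (u_cl : {within closure Omega `*` times T, continuous (fun p => u p.1 p.2)})
  (u_bd : forall x t, boundary Omega x -> times T t -> u x t = 0)
  (u_lt1 : forall x t, closure Omega x -> times T t -> u x t < 1).
Variables (t1 t2 : R).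
Hypotheses (Tt1 : times T t1) (Tt2 : times T t2).

Let C := closure Omega `*` [set t | t1 <= t <= t2].

Let cC : compact C.
Proof.
rewrite /C (_ : [set t | _] = `[t1, t2]%classic).
  by apply: compact_setX; [exact: compact_closure|exact: segment_compact].
by apply/seteqP; split=> t /=; rewrite in_itv.
Qed.

Let CT : C `<=` closure Omega `*` times T.
Proof. by move=> [x t] [/= cx t12]; split=> //; exact: times_sub t12. Qed.

Let u_C : {within C, continuous (fun p => u p.1 p.2)}.
Proof. exact: continuous_subspaceW CT u_cl. Qed.

Lemma solution_bounded : exists2 M : R, 0 <= M &
  forall x t, Omega x -> t1 <= t <= t2 -> - M <= u x t.
Proof.
have /compact_bounded/ex_strict_bound_gt0[M M0 HM] := continuous_compact u_C cC.
exists M; first exact: ltW.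
move=> x t Ox t12; have := HM (u x t); rewrite /= ltr_norml.
case/(_ _)/andP; last by move=> /ltW.
by exists (x, t) => //; split=> //=; exact: subset_closure.
Qed.

(** The function [rho] is positive on the compact cylinder: inside because [phi > 0], on the
    boundary because [u = 0] and [H 0 < kappa]. With [d] half of its minimum, [phi <= d] forces the
    other entry of the maximum to be positive. *)
Lemma near_boundary (H : R -> R) kappa :
  (forall s : R, s < 1 -> {for s, continuous H}) -> H 0 < kappa ->
  exists2 d : R, 0 < d & forall x t, Omega x -> t1 <= t <= t2 ->
    phi x <= d -> H (u x t) <= kappa.
Proof.
move=> cH H0.
have [C0|/set0P C0] := eqVneq C set0.
  exists 1 => // x t Ox t12 _; exfalso.
  have : C (x, t) by split=> //=; exact: subset_closure.
  by rewrite C0.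
pose rho (p : 'rV[R]_n * R) := Num.max (phi p.1) (kappa - H (u p.1 p.2)).
have c1 : {within C, continuous (fun p => phi p.1)}.
  apply/subspace_continuousP => -[x t] [/= cx _] W /= phiW.
  have /subspace_continuousP/(_ x cx)/(_ W phiW) := phi_cl.
  move=> H1; have : \forall y \near x, closure Omega y -> W (phi y) by exact: H1.
  move=> /(near_fst t) H2; rewrite /within /= /nbhs /=.
  by apply: filterS H2 => -[y r] /= H3 [/= /H3].
have c2 : {within C, continuous (fun p => kappa - H (u p.1 p.2))}.
  rewrite continuous_subspace_in => p pC.
  have [cx Tt] : closure Omega p.1 /\ times T p.2.
    by have /CT[] := set_mem pC.
  have cu := @u_C p.
  have cHu := @continuous_comp (subspace C) R R (fun p => u p.1 p.2) H p cu
    (cH _ (u_lt1 cx Tt)).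
  exact: (continuous_atB (@cst_continuous (subspace C) R kappa p) cHu).
have crho : {within C, continuous rho}.
  by move=> p; exact: (continuous_max (c1 p) (c2 p)).
have [p pC minp] := compact_EVT_min C0 cC crho.
have rho0 : 0 < rho p.
  have [cx t12] := set_mem pC; rewrite /rho lt_max.
  have [Ox|Ox] := pselect (Omega p.1); first by rewrite phi_gt0.
  have [_ Tt] := CT (set_mem pC).
  by rewrite u_bd ?subr_gt0 ?H0 ?orbT//; exact: closure_boundary.
exists (rho p / 2); first by rewrite divr_gt0.
move=> x t Ox t12 phix.
have xtC : (x, t) \in C by rewrite inE; split=> //=; exact: subset_closure.
have := minp _ xtC; rewrite [in X in _ <= X]/rho /= le_max => /orP[|]; first lra.
by move=> h; have : 0 < kappa - H (u x t) by [exact: lt_le_trans h]; rewrite subr_gt0 => /ltW.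
Qed.

End near_boundary.

(** * Initial energy *)

Section unpacking.
Context {R : realType} {n : nat} (Omega : set 'rV[R]_n).
Hypotheses (oO : open Omega).

Lemma C2_on_pure_C2 v : C2_on Omega v -> pure_C2 Omega v.
Proof.
move=> [cv c1 c2] x Ox.
have co (h : 'rV[R]_n -> R) : {within Omega, continuous h} -> {for x, continuous h}.
  by rewrite continuous_open_subspace// => /(_ x); rewrite inE; exact.
split; first exact: co.
move=> i; have [d1 cd1] := c1 i; have [d2 cd2] := c2 i i.
by split; [exact: d1|exact: co|exact: d2|exact: co].
Qed.

Lemma open_times (T : \bar R) : open (times T).
Proof.
rewrite (_ : times T = [set t | 0 < t] `&` [set t | (t%:E < T)%E]); last first.
  by apply/seteqP; split=> t; rewrite /times /= lte_fin; [move/andP|case=> -> ->].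
apply: openI; first exact: open_gt.
case: T => [r| |].
- rewrite (_ : [set t | _] = [set t | t < r]); first exact: open_lt.
  by apply/seteqP; split=> t /=; rewrite lte_fin.
- rewrite (_ : [set t | _] = setT); first exact: openT.
  by apply/seteqP; split=> t //= _; rewrite ltry.
- rewrite (_ : [set t | _] = set0); first exact: open0.
  by apply/seteqP; split=> t //=.
Qed.

Variables (T : \bar R) (u : 'rV[R]_n -> R -> R).

Let within_QP (F : 'rV[R]_n * R -> R) : {within Omega `*` times T, continuous F} ->
  forall x t, Omega x -> times T t -> {for (x, t), continuous F}.
Proof.
move=> + x t Ox Tt; rewrite continuous_open_subspace; last first.
  rewrite openE => -[y r] [/= Oy Tr]; exists (Omega, times T) => //=.
  split; first exact: open_nbhs_nbhs.
  by apply: open_nbhs_nbhs; split => //; exact: open_times.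
by move=> /(_ (x, t)); rewrite inE; apply; split.
Qed.

Lemma C21_on_pure_C2 : C21_on Omega T u ->
  forall t, times T t -> pure_C2 Omega (u ^~ t).
Proof.
move=> [cu _ c1 c2] t Tt x Ox; split.
  exact: (continuous_at_pairl (within_QP cu Ox Tt)).
move=> i; have [d1 cd1] := c1 i; have [d2 cd2] := c2 i i; split.
- exact: d1.
- exact: (continuous_at_pairl (within_QP cd1 Ox Tt)).
- exact: d2.
- exact: (continuous_at_pairl (within_QP cd2 Ox Tt)).
Qed.

Lemma C21_on_time : C21_on Omega T u -> forall x t, Omega x -> times T t ->
  [/\ {for (x, t), continuous (fun p => u p.1 p.2)},
      derivable (u x) t 1 &
      {for (x, t), continuous (fun p => (u p.1)^`()%classic p.2)}].
Proof.
move=> [cu [du cdu] _ _] x t Ox Tt; split.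
- exact: (within_QP cu Ox Tt).
- exact: du.
- exact: (within_QP cdu Ox Tt).
Qed.

End unpacking.

Lemma solution_lt1 (R : realType) n (Omega : set 'rV[R]_n) f g lambda u0 T u :
  solution Omega f g lambda u0 T u ->
  forall x t, closure Omega x -> times T t -> u x t < 1.
Proof.
move=> [_ [[_ _ _ _ us] _]] x t cx Tt.
rewrite -lte_fin; apply: le_lt_trans (us t Tt); apply: ereal_sup_ubound.
exists (x, t) => //=; split=> //=; rewrite in_itv/= lexx andbT.
by case/andP: Tt; rewrite lte_fin.
Qed.

(** * Comparison with the initial value *)

Section initial_energy.
Context {R : realType} {n : nat} (Omega : set 'rV[R]_n).
Hypotheses (oO : open Omega).
Variables (G g : R -> R) (L Fp : R).
Hypotheses (G_gt0 : forall s, s < 1 -> 0 < G s)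
  (G_noninc : forall s t, s <= t -> t < 1 -> G t <= G s)
  (G_cont : forall s : R, s < 1 -> {for s, continuous G})
  (G_le : forall s, s < 1 -> G s <= L) (L_ge0 : 0 <= L)
  (g_gt0 : forall s, s < 1 -> 0 < g s)
  (g_noninc : forall s t, s <= t -> t < 1 -> g t <= g s)
  (g_cont : forall s : R, s < 1 -> {for s, continuous g})
  (H_le : forall v, H_of G v <= H_of g v).
Variables (v u0 w phi : 'rV[R]_n -> R) (a : R).
Hypotheses (w_ge0 : forall x, Omega x -> 0 <= w x)
  (w_le : forall x, Omega x -> w x <= phi x)
  (phi_le : forall x, Omega x -> phi x <= Fp)
  (phi_m : measurable_fun Omega phi)
  (v_lt1 : forall x, Omega x -> v x < 1)
  (v_m : measurable_fun Omega v)
  (u0_m : measurable_fun Omega u0)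
  (a_lt1 : a < 1)
  (u0_le : {ae lebesgue_rV R n, forall x, Omega x -> u0 x <= a})
  (Hvw_int : (lebesgue_rV R n).-integrable Omega
     (EFin \o (fun x => H_of G (v x) * w x))).

(** Pointwise, [w] is raised to [phi], the Lipschitz bound moves from [v] to [u0], and [G] is raised
    to [g]. The right side is an extended real because the integral of [H_of g (u0 x) * phi x] may
    be infinite. *)
Lemma initial_energy :
  ((\int[lebesgue_rV R n]_(x in Omega) (H_of G (v x) * w x))%:E <=
  \int[lebesgue_rV R n]_(x in Omega) (H_of g (u0 x) * phi x)%:E +
  (L * Fp)%:E * \int[lebesgue_rV R n]_(x in Omega) `|v x - u0 x|%:E)%E.
Proof.
have mO := open_measurable_rV oO.
have phi_ge0 x : Omega x -> 0 <= phi x.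
  by move=> Ox; rewrite (le_trans (w_ge0 Ox))// w_le.
have mHu0 : measurable_fun Omega (fun x => H_of g (u0 x)).
  have mH : measurable_fun [set: R] (H_of g).
    apply: nonincreasing_measurable => // s t st.
    exact: (H_of_nonincreasing g_gt0 g_noninc g_cont).
  exact: (measurableT_comp mH u0_m).
have md : measurable_fun Omega (fun x => `|v x - u0 x|).
  by apply: measurableT_comp => //; exact: measurable_funB.
have LF0 x : Omega x -> 0 <= L * Fp.
  by move=> Ox; rewrite mulr_ge0// (le_trans (phi_ge0 _ Ox))// phi_le.
have mHp : measurable_fun Omega (fun x => H_of g (u0 x) * phi x).
  exact: measurable_funM.
have H0 x : Omega x -> 0 <= H_of g (u0 x) * phi x.
  by move=> Ox; rewrite mulr_ge0// ?phi_ge0// H_of_ge0.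
(* [Fp] is known to be nonnegative only through a point of [Omega], so the empty set is treated
   apart. *)
have [/set0P[y Oy]|/negPn/eqP O0] := boolP (Omega != set0); last first.
  by rewrite /Rintegral O0 !integral_set0 mule0 adde0.
rewrite -ge0_integralZl_EFin//; last 2 first.
  - exact/measurable_EFinP.
  - exact: LF0 Oy.
have h1 x : Omega x -> (0 <= (H_of g (u0 x) * phi x)%:E)%E.
  by move=> Ox; rewrite lee_fin H0.
have h2 : measurable_fun Omega (fun x => (H_of g (u0 x) * phi x)%:E).
  exact/measurable_EFinP.
have h3 x : Omega x -> (0 <= (L * Fp)%:E * `|v x - u0 x|%:E)%E.
  by move=> Ox; rewrite mule_ge0// lee_fin// (LF0 y).
have h4 : measurable_fun Omega (fun x => (L * Fp)%:E * `|v x - u0 x|%:E)%E.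
  by apply: measurable_funeM; exact/measurable_EFinP.
rewrite -(ge0_integralD _ mO h1 h2 h3 h4).
rewrite /Rintegral fineK; last exact: integrable_fin_num.
apply: ae_ge0_le_integral => //.
- by move=> x Ox; rewrite lee_fin mulr_ge0// ?w_ge0// H_of_ge0.
- exact: measurable_int Hvw_int.
- by move=> x Ox; rewrite adde_ge0 ?h1 ?h3.
- exact: emeasurable_funD.
apply: filterS u0_le => x u0a Ox; rewrite -EFinM -EFinD lee_fin.
have u01 : u0 x < 1 by rewrite (le_lt_trans (u0a Ox)).
have := H_of_lipschitz G_gt0 G_noninc G_cont G_le (v_lt1 Ox) u01.
have := H_le (u0 x); have := H_of_ge0 G_gt0 (v x).
have := w_ge0 Ox; have := w_le Ox; have := phi_le Ox; have := phi_ge0 x Ox.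
move: (H_of G (v x)) (H_of G (u0 x)) (H_of g (u0 x)) => b1 b2 b3 p0 pF wp w0 b10 b23 b12.
have d0 : 0 <= `|v x - u0 x| by [].
move: (`|v x - u0 x|) d0 b12 => d d0 b12.
apply: (@le_trans _ _ (b1 * phi x)); first exact: ler_wpM2l.
apply: (@le_trans _ _ ((b3 + L * d) * phi x)).
  by rewrite ler_wpM2r// (le_trans b12)// lerD2r.
rewrite mulrDl lerD2l mulrAC ler_wpM2r// ler_wpM2l//.
Qed.

End initial_energy.

(** * The touchdown estimate *)

Section touchdown.
Context {R : realType} {n : nat} (Omega : set 'rV[R]_n).
Variables (f : 'rV[R]_n -> R) (alpha : R) (g : R -> R) (mu : R)
  (phi : 'rV[R]_n -> R) (lambda : R) (u0 : 'rV[R]_n -> R) (a : R)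
  (T : \bar R) (u : 'rV[R]_n -> R -> R).
Hypotheses (oO : open Omega) (bO : bounded_set Omega)
  (alpha_gt0 : 0 < alpha)
  (f_ge0 : forall x, closure Omega x -> 0 <= f x)
  (f_hoelder : hoelder_on alpha (closure Omega) f)
  (f_neq0 : exists2 x, closure Omega x & f x != 0)
  (g_gt0 : forall s, s < 1 -> 0 < g s)
  (g_C2 : C2_lt1 g)
  (g'_le0 : forall s, s < 1 -> g^`()%classic s <= 0)
  (mu_gt0 : 0 < mu)
  (phi_eig : normalized_eigenfunction Omega mu phi)
  (u0_m : measurable_fun Omega u0)
  (a_lt1 : a < 1)
  (u0_le : {ae lebesgue_rV R n, forall x, Omega x -> u0 x <= a})
  (u_sol : solution Omega f g lambda u0 T u).

Let f_cl : {within closure Omega, continuous f}.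
Proof. exact: hoelder_on_continuous f_hoelder. Qed.

Let phi_gt0 x : Omega x -> 0 < phi x.
Proof. by have [_ + _] := phi_eig; exact. Qed.

Let phi_cl : {within closure Omega, continuous phi}.
Proof. by have [[]] := phi_eig. Qed.

Let H0 := H_of g 0.
Let Fi := integral_f_phi Omega f phi.

Let H0_ge0 : 0 <= H0.
Proof. exact: H_of_ge0. Qed.

Let fphi_int :
  (lebesgue_rV R n).-integrable Omega (EFin \o (fun x => f x * phi x)).
Proof.
have [Fm _ HF] := within_closure_bounded bO f_cl.
have fF x : Omega x -> f x <= Fm.
  by move=> Ox; exact: le_trans (ler_norm _) (HF x (subset_closure Ox)).
exact: (fphi_integrable oO bO phi_cl phi_gt0 f_cl
  (fun x Ox => f_ge0 (subset_closure Ox)) fF).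
Qed.

Lemma integral_f_phi_gt0 : 0 < integral_f_phi Omega f phi.
Proof.
have [y cy fy] := f_neq0.
(* The point where [f] is nonzero may lie on the boundary; continuity moves it into [Omega]. *)
have fy0 : - f y < 0 by rewrite oppr_lt0 lt_neqAle eq_sym fy f_ge0.
have Nf_cl : {within closure Omega, continuous (fun x => - f x)}.
  by move=> x; apply: continuousN; exact: f_cl.
have [x [Ox fx]] := cy _ (within_near_lt Nf_cl cy fy0).
have {}fx : 0 < f x by rewrite -oppr_lt0; exact/fx/subset_closure.
apply: (integral_gt0 oO fphi_int _ Ox).
- by move=> z Oz; rewrite mulr_ge0 ?f_ge0 ?(ltW (phi_gt0 Oz))//; exact: subset_closure.
- exact: (continuous_atM (within_closure_open oO f_cl Ox)
    (within_closure_open oO phi_cl Ox)).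
- by rewrite mulr_gt0// phi_gt0.
Qed.

(** The error [eps] pays in thirds for the L^1 distance at [t'], the gap between [kappa] and [H0],
    and the replacement of [phi] by [w]. The term [mu * H0 * t1] is the price of ignoring the source
    before [t1]. *)
Lemma energy_estimate t1 t2 eps r : 0 <= lambda ->
  times T t1 -> times T t2 -> t1 < t2 -> 0 < eps ->
  (\int[lebesgue_rV R n]_(x in Omega) (H_of g (u0 x) * phi x)%:E)%E = r%:E ->
  (lambda * Fi - mu * H0) * (t2 - t1) <= r + mu * H0 * t1 + eps.
Proof.
move=> lambda_ge0 Tt1 Tt2 t12 eps0 rE.
have mO := open_measurable_rV oO.
have u_lt1c := solution_lt1 u_sol.
have [_ [[u_C21 u_cl u_eq u_bd _] u_init]] := u_sol.
have u_lt1 x t : Omega x -> times T t -> u x t < 1.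
  by move=> /subset_closure Ox; exact: u_lt1c.
have u_C2 := C21_on_pure_C2 oO u_C21.
have u_cont x t (Ox : Omega x) (Tt : times T t) := let: And3 c _ _ :=
  C21_on_time oO u_C21 Ox Tt in c.
have u_der x t (Ox : Omega x) (Tt : times T t) := let: And3 _ c _ :=
  C21_on_time oO u_C21 Ox Tt in c.
have u_dcont x t (Ox : Omega x) (Tt : times T t) := let: And3 _ _ c :=
  C21_on_time oO u_C21 Ox Tt in c.
have [[phi_C2on _ phi_lap phi_bd _] _ phi_int1] := phi_eig.
have phi_C2 := C2_on_pure_C2 oO phi_C2on.
have phi_eq x : Omega x -> laplacian phi x = - (mu * phi x).
  by move=> Ox; rewrite -phi_lap// opprK.
have phi_int : \int[lebesgue_rV R n]_(x in Omega) phi x = 1.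
  by rewrite /Rintegral phi_int1.
have [Fm Fm0 HFm] := within_closure_bounded bO f_cl.
have f_le x : Omega x -> f x <= Fm.
  by move=> Ox; exact: le_trans (ler_norm _) (HFm x (subset_closure Ox)).
have f_geO x : Omega x -> 0 <= f x by move=> /subset_closure/f_ge0.
have [Fp Fp0 HFp] := within_closure_bounded bO phi_cl.
have phi_le x : Omega x -> phi x <= Fp.
  by move=> Ox; exact: le_trans (ler_norm _) (HFp x (subset_closure Ox)).
have [M M0 HM] := solution_bounded bO u_cl Tt1 Tt2.
pose G := flatten_below g M; pose G1 := flatten_below1 g M.
pose L := g (- M - 1).
have L0 : 0 < L.
  apply: g_gt0; rewrite (lt_trans _ ltr01)// ltrBlDr add0r.
  by rewrite (le_lt_trans _ ltr01)// oppr_le0.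
have G_gt0 : forall s, s < 1 -> 0 < G s := flatten_below_gt0 g_gt0 M0.
have G_noninc := flatten_below_nonincreasing g_C2 g'_le0 M0.
have G_cont := flatten_below_continuous g_C2 M0.
have G_der := is_derive_flatten_below g_C2 M0.
have G1_cont := flatten_below1_continuous g_C2 M0.
have G1_le0 := flatten_below1_le0 g'_le0 M0.
pose V := fine (lebesgue_rV R n Omega).
have V0 : 0 <= V by exact: fine_ge0.
have t10 : 0 < t1 by case/andP: Tt1; rewrite lte_fin.
have t20 : 0 < t2 by exact: lt_trans t12.
pose N t := (\int[lebesgue_rV R n]_(x in Omega) `|u x t - u0 x|%:E)%E.
(* [L * Fp] multiplies the L^1 error in [initial_energy]; the added 1 keeps the denominator positive
   and the quotient by it at most 1, here as for [eta] and [e] below. *)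
pose q := eps / (3 * (L * Fp + 1)).
have q0 : 0 < q by rewrite divr_gt0// mulr_gt0// addr_gt0// mulr_gt0.
have [t' [t'0 t't1 Nt']] : exists t', [/\ 0 < t', t' < t1 & (N t' < q%:E)%E].
  have nN : \forall t \near (0:R)^'+, (N t < q%:E)%E.
    have H : nbhs (0%:E : \bar R) [set y | (y < q%:E)%E].
      apply: open_nbhs_nbhs; split; first exact: open_ereal_lt_ereal.
      by rewrite /= lte_fin.
    exact: (u_init _ H).
  near ((0:R)^'+) => t'; exists t'; split; near: t'.
  - exact: nbhs_right_gt.
  - exact: nbhs_right_lt.
  - exact: nN.
have Tt' : times T t'.
  apply/andP; rewrite lte_fin t'0; split=> //.
  by case/andP: Tt1 => _; apply: lt_trans; rewrite lte_fin.
pose eta := eps / (3 * (mu * t2 + 1)).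
have mt0 : 0 < mu * t2 by rewrite mulr_gt0.
have eta0 : 0 < eta by rewrite divr_gt0// mulr_gt0// addr_gt0.
pose kappa := H0 + eta.
have H_cont (s : R) : s < 1 -> {for s, continuous (H_of G)}.
  move=> s1; have [d _] := is_derive_H_of G_gt0 G_noninc G_cont s1.
  by apply: differentiable_continuous; exact/derivable1_diffP.
have HG0 : H_of G 0 < kappa.
  by rewrite (H_of_flatten_below0 _ M0) /kappa ltrDl.
have [d d0 Hd] := near_boundary oO bO phi_cl phi_gt0 u_cl u_bd u_lt1c Tt' Tt2
  H_cont HG0.
pose c0 := 2 * lambda * Fm * V.
have c00 : 0 <= c0 by rewrite /c0 !mulr_ge0// ltW.
(* The first entry puts [phi <= 3 * e] inside the layer of width [d]; the second keeps the cut-off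
   loss [e * c0] small over a time at most [t2]. *)
pose e := Num.min (d / 3) (eps / (3 * (c0 * t2 + 1))).
have ct0 : 0 <= c0 * t2 by rewrite mulr_ge0// ltW.
have e0 : 0 < e.
  by rewrite lt_min !divr_gt0// mulr_gt0// ltr_wpDl.
have e3 : 3 * e <= d.
  by rewrite mulrC -ler_pdivlMr// ge_min lexx.
have k0 : 0 <= kappa by rewrite addr_ge0// ltW.
pose w := cut_phi Omega phi e.
pose E := energy Omega u G w.
have w_ge0 x : Omega x -> 0 <= w x.
  by move=> Ox; rewrite /w cut_phiE//; have [] := smooth_cut_bounds (phi x) e0.
have w_le x : Omega x -> w x <= phi x.
  move=> Ox; rewrite /w cut_phiE//; have [_ _ _] := smooth_cut_bounds (phi x) e0.
  by apply; exact/ltW/phi_gt0.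
have decay := energy_decay oO bO u_C2 u_cont u_der u_dcont u_lt1 G_gt0 G_noninc
  G_der G1_cont G1_le0 phi_C2 phi_cl phi_eq phi_bd phi_gt0 phi_int (ltW mu_gt0)
  f_cl f_geO f_le g_gt0 lambda_ge0 u_eq e0 k0.
(* The floor [- M] holds on [[t1, t2]], so [G] equals [g] along [u] and [c = 1]. *)
have D2 : E t2 <= E t1 + (kappa * mu - lambda * 1 * Fi +
    2 * lambda * 1 * e * Fm * V) * (t2 - t1).
  apply: decay => // [|x t Ox t12'|x t Ox /andP[t1t tt2] phix].
  - exact: ltW.
  - by rewrite mul1r /G flatten_belowE ?HM.
  - apply: Hd => //; last exact: le_trans phix e3.
    by rewrite (le_trans (ltW t't1)).
(* Before [t1] the solution may drop below [- M]; [c = 0] asks only for [0 <= G]. *)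
have D1 : E t1 <= E t' + (kappa * mu - lambda * 0 * Fi +
    2 * lambda * 0 * e * Fm * V) * (t1 - t').
  apply: decay => // [|x t Ox t12'|x t Ox /andP[t1t tt2] phix].
  - exact: ltW.
  - have Tt := times_sub Tt' Tt1 t12'.
    by rewrite mul0r ltW// G_gt0// u_lt1.
  - apply: Hd => //; last exact: le_trans phix e3.
    by rewrite t1t (le_trans tt2)// ltW.
have E2 : 0 <= E t2.
  by apply: Rintegral_ge0 => x Ox; rewrite mulr_ge0 ?w_ge0// H_of_ge0.
have cont_m (h : 'rV[R]_n -> R) : (forall x, Omega x -> {for x, continuous h}) ->
    measurable_fun Omega h.
  by move=> ch; apply: continuous_measurable_rV => // x /[!inE]; exact: ch.
have cw := (cut_phi_C2 oO phi_C2 phi_eq e0).1.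
have vw := cut_phi_vanishes oO phi_cl phi_bd e0.
have LFp0 : 0 <= L * Fp by rewrite mulr_ge0// ltW.
have D0 : E t' <= r + L * Fp * q.
  rewrite -lee_fin.
  have := @initial_energy R n Omega oO G g L Fp G_gt0 G_noninc G_cont
    (flatten_below_bounded g_C2 g'_le0 M0) (ltW L0) g_gt0
    (C2_lt1_nonincreasing g_C2 g'_le0) (C2_lt1_continuous g_C2)
    (H_of_flatten_below_le g_gt0 g_C2 g'_le0 M0) (u ^~ t') u0 w phi a
    w_ge0 w_le phi_le.
  rewrite rE => /(_ _ _ _ u0_m a_lt1 u0_le _)/le_trans; apply.
  - by apply: cont_m => x Ox; exact: (within_closure_open oO phi_cl Ox).
  - by move=> x Ox; exact: u_lt1.
  - by apply: cont_m => x Ox; exact: (continuous_at_pairl (u_cont x t' Ox Tt')).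
  - exact: (energy_integrand_integrable oO bO u_cont u_lt1 G_gt0 G_noninc G_der).
  - rewrite EFinD leeD2l// [leRHS]EFinM lee_wpmul2l ?lee_fin//.
    exact: ltW.
have A1 : L * Fp * q <= eps / 3.
  rewrite /q invfM mulrA -[leRHS]mul1r mulrC.
  rewrite [X in X <= _](_ : _ = (L * Fp / (L * Fp + 1)) * (eps / 3)); last by ring.
  rewrite ler_pM2r ?divr_gt0// ler_pdivrMr ?mul1r ?lerDl//.
  by rewrite ltr_wpDl.
have A2 : eta * (mu * t2) <= eps / 3.
  rewrite /eta invfM.
  rewrite [X in X <= _](_ : _ = (mu * t2 / (mu * t2 + 1)) * (eps / 3)); last by ring.
  rewrite -[leRHS]mul1r ler_pM2r ?divr_gt0// ler_pdivrMr ?mul1r ?lerDl//.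
  by rewrite addr_gt0.
have A3 : e * (c0 * t2) <= eps / 3.
  apply: (@le_trans _ _ (eps / (3 * (c0 * t2 + 1)) * (c0 * t2))).
    by rewrite ler_wpM2r// ge_min lexx orbT.
  rewrite invfM.
  rewrite [X in X <= _](_ : _ = (c0 * t2 / (c0 * t2 + 1)) * (eps / 3)); last by ring.
  rewrite -[leRHS]mul1r ler_pM2r ?divr_gt0// ler_pdivrMr ?mul1r ?lerDl//.
  by rewrite ltr_wpDl.
have B2 : eta * mu * (t2 - t') <= eta * (mu * t2).
  by rewrite -mulrA ler_wpM2l ?(ltW eta0)// ler_wpM2l ?(ltW mu_gt0)// gerBl ltW.
have B3 : e * c0 * (t2 - t1) <= e * (c0 * t2).
  by rewrite -mulrA ler_wpM2l ?(ltW e0)// ler_wpM2l// gerBl ltW.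
have B1 : 0 <= mu * H0 * t' by rewrite !mulr_ge0// ltW.
rewrite -/Fi in D1 D2.
have D2' : E t2 <= E t1 + mu * H0 * (t2 - t1) + eta * mu * (t2 - t1)
    - lambda * Fi * (t2 - t1) + e * c0 * (t2 - t1).
  by rewrite (le_trans D2)// le_eqVlt /kappa /c0; apply/orP; left; apply/eqP; ring.
have D1' : E t1 <= E t' + mu * H0 * (t1 - t') + eta * mu * (t1 - t').
  by rewrite (le_trans D1)// le_eqVlt /kappa; apply/orP; left; apply/eqP; ring.
have S1 : eta * mu * (t2 - t') = eta * mu * (t2 - t1) + eta * mu * (t1 - t') by ring.
have S2 : mu * H0 * (t1 - t') = mu * H0 * t1 - mu * H0 * t' by ring.
have S3 : (lambda * Fi - mu * H0) * (t2 - t1) =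
  lambda * Fi * (t2 - t1) - mu * H0 * (t2 - t1) by ring.
rewrite S3; rewrite S1 in B2; rewrite S2 in D1'.
move: (eta * mu * (t2 - t1)) (eta * mu * (t1 - t')) (lambda * Fi * (t2 - t1))
  (mu * H0 * (t2 - t1)) (mu * H0 * t1) (mu * H0 * t') (E t1) (E t2) (E t')
  (e * c0 * (t2 - t1)) (L * Fp * q) (eta * (mu * t2)) (e * (c0 * t2))
  A1 A2 A3 B1 B2 B3 D0 D1' D2' E2 {S1 S2 S3 D1 D2}; move=> *; lra.
Unshelve. all: by end_near. Qed.

Lemma initial_energy_ge0 :
  (0 <= \int[lebesgue_rV R n]_(x in Omega) (H_of g (u0 x) * phi x)%:E)%E.
Proof.
apply: integral_ge0 => x Ox; rewrite lee_fin mulr_ge0 ?(ltW (phi_gt0 Ox))//.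
exact: H_of_ge0.
Qed.

Lemma existence_time_bound t2 : 0 <= lambda -> times T t2 ->
  (((lambda * Fi - mu * H0) * t2)%:E <=
   \int[lebesgue_rV R n]_(x in Omega) (H_of g (u0 x) * phi x)%:E)%E.
Proof.
move=> lambda_ge0 Tt2; have := initial_energy_ge0.
case E0 : (integral _ _ _) => [r| |] // _; last by rewrite leey.
rewrite lee_fin; apply/ler_addgt0Pr => eps eps0.
have [t20 t2T] : 0 < t2 /\ (t2%:E < T)%E by case/andP: Tt2; rewrite lte_fin.
set D := lambda * Fi - mu * H0.
(* [t1] enters the estimate through [mu * H0 * t1] and through [D * t1]; the absolute value is taken
   because [D] may have either sign under [0 <= lambda]. *)
pose C := mu * H0 + `|D|.
have C0 : 0 <= C by rewrite addr_ge0// mulr_ge0// ltW.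
pose t1 := Num.min (t2 / 2) (eps / (2 * (C + 1))).
have t10 : 0 < t1 by rewrite lt_min !divr_gt0// mulr_gt0// ltr_wpDl.
have t12 : t1 < t2 by rewrite gt_min ltr_pdivrMr// ltr_pMr// ltr1n.
have Tt1 : times T t1.
  by apply/andP; rewrite lte_fin t10 (lt_trans _ t2T)// lte_fin.
have eps20 : 0 < eps / 2 by rewrite divr_gt0.
have B := energy_estimate lambda_ge0 Tt1 Tt2 t12 eps20 E0.
have Ct1 : C * t1 <= eps / 2.
  apply: (@le_trans _ _ (C * (eps / (2 * (C + 1))))).
    by rewrite ler_wpM2l// ge_min lexx orbT.
  rewrite invfM.
  rewrite [X in X <= _](_ : _ = (C / (C + 1)) * (eps / 2)); last by ring.
  rewrite -[leRHS]mul1r ler_pM2r// ler_pdivrMr ?mul1r ?lerDl//.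
  by rewrite ltr_wpDl.
have Dt1 : D * t1 <= `|D| * t1 by rewrite ler_wpM2r ?ler_norm// ltW.
have S : D * (t2 - t1) = D * t2 - D * t1 by ring.
have S' : C * t1 = mu * H0 * t1 + `|D| * t1 by rewrite /C; ring.
rewrite -/D S in B; rewrite S' in Ct1.
move: (D * t2) (D * t1) (`|D| * t1) (mu * H0 * t1) B Ct1 Dt1 => d2 d1 d3 m1.
by move=> *; lra.
Qed.

End touchdown.

Unset Implicit Arguments.

Theorem theorem3p6 (R : realType) (n : nat) (Omega : set 'rV[R]_n)
    (f : 'rV[R]_n -> R) (alpha : R) (g : R -> R)
    (mu1 : R) (phi1 : 'rV[R]_n -> R) (lambda : R)
    (u0 : 'rV[R]_n -> R) (a : R)
    (T : \bar R) (u : 'rV[R]_n -> R -> R) (Tlambda : \bar R)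
    (n_gt0 : (0 < n)%N)
    (Omega_domain : bounded_C2_domain Omega)
    (alpha01 : 0 < alpha < 1)
    (f_ge0 : forall x, closure Omega x -> 0 <= f x)
    (f_hoelder : hoelder_on alpha (closure Omega) f)
    (f_neq0 : exists2 x, closure Omega x & f x != 0)
    (g_gt0 : forall s, s < 1 -> 0 < g s)
    (g_C2 : C2_lt1 g)
    (g_noninc : forall s, s < 1 -> g^`()%classic s <= 0)
    (mu1_gt0 : 0 < mu1)
    (mu1_first : first_dirichlet_eigenvalue Omega mu1)
    (phi1_eig : normalized_eigenfunction Omega mu1 phi1)
    (lambda_gt : lambda' Omega f g mu1 phi1 < lambda)
    (u0_L1 : (lebesgue_rV R n).-integrable Omega (EFin \o u0))
    (a01 : 0 < a < 1)
    (u0_le : {ae lebesgue_rV R n, forall x, Omega x -> u0 x <= a})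
    (u_sol : maximal_solution Omega f g lambda u0 T u)
    (u_touchdown : touchdown_time Omega T u Tlambda) :
  (Tlambda <= (1 / (lambda - lambda' Omega f g mu1 phi1))%:E *
    (\int[lebesgue_rV R n]_(x in Omega) (H_of g (u0 x) * phi1 x)%:E *
      (integral_f_phi Omega f phi1)^-1%:E))%E.
Proof.
have [_ oO _ bO _] := Omega_domain.
have [/andP[alpha_gt0 _] /andP[_ a_lt1]] := (alpha01, a01).
have [sol _] := u_sol.
have u0_m : measurable_fun Omega u0 by exact/measurable_EFinP/measurable_int/u0_L1.
have Fi0 := integral_f_phi_gt0 oO bO alpha_gt0 f_ge0 f_hoelder f_neq0 phi1_eig.
(* A touchdown time is at most [T], so it suffices to bound the existence time itself. *)
have [/andP[_ Tl_le] _ _] := u_touchdown; apply: (le_trans Tl_le).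
have [T0 _] := sol.
have bound t2 := @existence_time_bound R n Omega f alpha g mu1 phi1 lambda u0 a T u
  oO bO alpha_gt0 f_ge0 f_hoelder g_gt0 g_C2 g_noninc mu1_gt0 phi1_eig
  u0_m a_lt1 u0_le sol t2.
have := initial_energy_ge0 u0 g_gt0 phi1_eig.
have H0 : 0 <= H_of g 0 by exact: H_of_ge0.
have l'E : lambda' Omega f g mu1 phi1 =
  mu1 * H_of g 0 / integral_f_phi Omega f phi1 by [].
move: (integral_f_phi Omega f phi1) Fi0 l'E bound => Fi Fi0 l'E bound.
have l0 : 0 <= lambda.
  by rewrite (le_trans _ (ltW lambda_gt))// l'E divr_ge0 ?(ltW Fi0)// mulr_ge0// ltW.
(* [lambda'] is the value of [lambda] at which the decay rate changes sign. *)
have DE : lambda * Fi - mu1 * H_of g 0 = (lambda - lambda' Omega f g mu1 phi1) * Fi.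
  by rewrite l'E; field; rewrite gt_eqF.
have D0 : 0 < lambda - lambda' Omega f g mu1 phi1 by rewrite subr_gt0.
move: (lambda - _) D0 DE => D D0 DE.
move: (integral _ _ _) bound => E0 bound E00.
(* Infinite initial energy makes the right-hand side [+oo], since both factors beside it are
   positive; [-oo] is excluded by nonnegativity. *)
case: E0 E00 bound => [r| |//] r0 bound; last first.
  by rewrite gt0_mulye ?lte_fin ?invr_gt0// gt0_muley ?lte_fin ?divr_gt0// leey.
rewrite lee_fin in r0; rewrite -!EFinM leNgt; apply/negP => rT.
have s0 : 0 <= 1 / D * (r / Fi) by rewrite mulr_ge0// divr_ge0// ltW.
(* If [T] exceeded the bound, some real time strictly between them, also when [T] is [+oo], would
   contradict the energy estimate. *)
have [t2 st2 t2T] : exists2 t2 : R, 1 / D * (r / Fi) < t2 & (t2%:E < T)%E.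
  case: T rT {T0 bound sol u_sol u_touchdown Tl_le} => [t| |//]; last first.
    by move=> _; exists (1 / D * (r / Fi) + 1); rewrite ?ltrDl ?ltry.
  rewrite lte_fin => st; exists ((1 / D * (r / Fi) + t) / 2); rewrite ?lte_fin.
    by rewrite ltr_pdivlMr// mulr_natr mulr2n ltrD2l.
  by rewrite ltr_pdivrMr// mulr_natr mulr2n ltrD2r.
have Tt2 : times T t2 by apply/andP; rewrite lte_fin (le_lt_trans s0).
have := bound t2 l0 Tt2; rewrite DE lee_fin leNgt => /negP; apply.
rewrite mulrC -ltr_pdivrMr ?mulr_gt0//.
by rewrite (_ : r / (D * Fi) = 1 / D * (r / Fi))//; field; rewrite !gt_eqF.
Qed.
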